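(* The following groups are $C^\ast$-simple: (i) Thompson's group $V$; (ii) the higher-dimensional groups $nV$, $n\ge2$; (iii) all the groups $V_G$, where $G$ is a countable self-similar group.
   Context: For a finite alphabet $\mathsf{X}$ with at least two letters, $\mathsf{X}^\ast$ is the set of finite words and $\mathsf{X}^{\mathbb{N}}$ the space of infinite sequences with the product topology; for $w\in\mathsf{X}^\ast$, $C_w\subset\mathsf{X}^{\mathbb{N}}$ is the cylinder of sequences with prefix $w$. Let $\mathcal{C}=\{0,1\}^{\mathbb{N}}$. Thompson's group $V$ is the group of homeomorphisms $g$ of $\mathcal{C}$ for which there exist cylinder partitions $\{C_{w_1},\dots,C_{w_m}\}$ and $\{C_{z_1},\dots,C_{z_m}\}$ of $\mathcal{C}$ such that $g(w_ix)=z_ix$ for every $i$ and every $x\in\mathcal{C}$. Brin's group $nV$ is the group of homeomorphisms $g$ of the Cantor $n$-cube $\mathcal{C}^n$ for which there exist two partitions of $\mathcal{C}^n$ into the same finite number $m$ of bricks (products of $n$ cylinders) $C_{w_i^1}\times\cdots\times C_{w_i^n}$ and $C_{z_i^1}\times\cdots\times C_{z_i^n}$, $1\le i\le m$, such that $g(w_i^1x_1,\dots,w_i^nx_n)=(z_i^1x_1,\dots,z_i^nx_n)$ for all $i$ and all $(x_1,\dots,x_n)\in\mathcal{C}^n$. A self-similar group over $\mathsf{X}$ is a group $G$ with a faithful action on $\mathsf{X}^\ast$ such that for every $g\in G$ and $x\in\mathsf{X}$ there exist $h\in G$ and $y\in\mathsf{X}$ with $g(xw)=y\,h(w)$ for all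 $w\in\mathsf{X}^\ast$; it acts by homeomorphisms on $\mathsf{X}^{\mathbb{N}}$. Nekrashevych's group $V_G$ is the group of homeomorphisms $f$ of $\mathsf{X}^{\mathbb{N}}$ for which there exist two cylinder partitions $\{C_{w_1},\dots,C_{w_m}\}$, $\{C_{z_1},\dots,C_{z_m}\}$ of $\mathsf{X}^{\mathbb{N}}$ and elements $g_1,\dots,g_m\in G$ such that $f(w_ix)=z_i\,g_i(x)$ for every $i$ and every $x\in\mathsf{X}^{\mathbb{N}}$. A group is $C^\ast$-simple if its reduced $C^\ast$-algebra is simple. *)

(* Defs.v *)
From HB Require Import structures.
From mathcomp Require Import all_boot all_order all_algebra monoid.
From mathcomp Require Import mathcomp_extra boolp classical_sets functions.
From mathcomp Require Import cardinality reals ereal constructive_ereal.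
From mathcomp Require Import topology esum cantor.
From mathcomp Require Import complex ring.

Set Implicit Arguments.
Unset Strict Implicit.
Unset Printing Implicit Defensive.

Import Order.TTheory GRing.Theory Num.Theory.
Import Normc.

Local Open Scope classical_set_scope.
Local Open Scope ring_scope.

Section HilbertSpace.
Context (R : realType) (G : groupType).

Definition square_summable : {pred G -> (R[i])^o} := fun f =>
  (\esum_(g in [set: G]) (normc (f g) ^+ 2)%:E < +oo)%E.

Fact square_summable_submod : subsemimod_closed square_summable.
Proof.
apply/GRing.submod_closed_semi; split.
  rewrite unfold_in /square_summable esum1 ?ltry// => g _.
  by rewrite [X in normc X]/= normc0 expr0n.
move=> a u v; rewrite !unfold_in /square_summable => su sv.
pose K := 2 * (normc a ^+ 2).
have scal (c : R) (f : G -> R) : 0 <= c ->  (forall g, 0 <= f g) ->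
    (\esum_(g in [set: G]) (f g)%:E < +oo)%E ->
    (\esum_(g in [set: G]) (c * f g)%:E < +oo)%E.
  move=> c0 f0 sf.
  have fin: \esum_(g in [set: G]) (f g)%:E \is a fin_num.
    rewrite ge0_fin_numE// esum_ge0// => g _; by rewrite lee_fin.
  apply: (@le_lt_trans _ _ (c%:E * \esum_(g in [set: G]) (f g)%:E)%E); last first.
    by rewrite -(fineK fin) -EFinM ltry.
  apply: ge_ereal_sup => _ [A [finA _] <-].
  apply: (@le_trans _ _ (c%:E * \sum_(x \in A) (f x)%:E)%E).
    by rewrite ge0_mule_fsumr// => g; rewrite lee_fin.
  apply: lee_wpmul2l; first by rewrite lee_fin.
  by apply: ereal_sup_ubound; exists A.
have K0 : 0 <= K by rewrite mulr_ge0// sqr_ge0.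
have S1 := scal K _ K0 (fun g => sqr_ge0 _) su.
have S2 := scal 2 _ (ler0n _ _) (fun g => sqr_ge0 _) sv.
apply: le_lt_trans (lte_add_pinfty S1 S2).
rewrite -esumD; last 2 first.
- by move=> g _; rewrite lee_fin mulr_ge0// sqr_ge0.
- by move=> g _; rewrite lee_fin mulr_ge0// sqr_ge0.
apply: le_esum => g _; rewrite -EFinD lee_fin /K.
rewrite -mulrA -exprMn -mulrDr.
have tri : normc ((a *: u + v) g) <= normc a * normc (u g) + normc (v g).
  rewrite -normcM.
  have := ler_normD (a * u g : Rcomplex R) (v g).
  exact.
have n0 (z : R[i]) : 0 <= normc z by case: z => x y; exact: sqrtr_ge0.
have sq : normc ((a *: u + v) g) ^+ 2 <= (normc a * normc (u g) + normc (v g)) ^+ 2.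
  by rewrite ler_sqr// ?nnegrE ?addr_ge0 ?mulr_ge0.
apply: (le_trans sq).
set x := _ * _; set y := normc _.
rewrite -subr_ge0 (_ : _ - _ = (x - y) ^+ 2) ?sqr_ge0//.
by ring.
Qed.

Fact square_summable_translate (g : G) (v : G -> (R[i])^o) :
  v \in square_summable -> (fun h => v (g^-1 * h)%g) \in square_summable.
Proof.
rewrite !unfold_in /square_summable => sv.
rewrite (_ : (\esum_(_ in _) _)%E =
    (\esum_(h in [set: G]) (normc (v h) ^+ 2)%:E)%E)//.
rewrite [RHS](reindex_esum [set: G] _ (fun h => (g^-1 * h)%g))//.
split=> [//|x y _ _ /mulgI //|y _ /=].
by exists (g * y)%g => //; rewrite mulKg.
Qed.

Record ell2 := Ell2 {
  ell2_val :> G -> (R[i])^o;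
  _ : ell2_val \in square_summable }.

HB.instance Definition _ := [isSub for ell2_val].
HB.instance Definition _ := [Choice of ell2 by <:].
HB.instance Definition _ :=
  GRing.SubChoice_isSubLmodule.Build _ _ _ ell2 square_summable_submod.

Definition ell2_norm (v : ell2) : R :=
  Num.sqrt (fine (\esum_(g in [set: G]) (normc (v g) ^+ 2)%:E)).

(* ||T|| <= M for the operator norm on ell2, when T is linear *)
Definition op_norm_le (T : ell2 -> ell2) (M : R) :=
  forall v, ell2_norm (T v) <= M * ell2_norm v.

Definition bounded_operators : set (ell2 -> ell2) :=
  [set T | linear T /\ exists M, op_norm_le T M].

Definition op_closure (A : set (ell2 -> ell2)) : set (ell2 -> ell2) :=
  [set T | bounded_operators T /\
    forall e : R, 0 < e -> exists2 S, A S & op_norm_le (T - S) e].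

Definition lregular (g : G) (v : ell2) : ell2 :=
  Ell2 (square_summable_translate g (valP v)).

Definition lregular_span : set (ell2 -> ell2) :=
  [set T | exists s : seq (R[i] * G), T = \sum_(p <- s) p.1 *: lregular p.2].

(* The span of the left translations is already closed under products and
   adjoints, so its norm closure is the C*-algebra that they generate. *)
Definition reduced_Cstar_algebra : set (ell2 -> ell2) :=
  op_closure lregular_span.

Definition closed_two_sided_ideal (A J : set (ell2 -> ell2)) :=
  [/\ J `<=` A, J 0,
      forall (a : R[i]) S T, J S -> J T -> J (a *: S + T),
      forall S T, A S -> J T -> J (S \o T) /\ J (T \o S)
    & op_closure J `<=` J].

Definition Cstar_simple := forall J,
  closed_two_sided_ideal reduced_Cstar_algebra J ->
  J = [set 0] \/ J = reduced_Cstar_algebra.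

End HilbertSpace.

Section Homeomorphisms.
Context (T : topologicalType).

Record homeo := Homeo {
  homeo_fun :> T -> T;
  homeo_inv : T -> T;
  homeo_funK : cancel homeo_fun homeo_inv;
  homeo_invK : cancel homeo_inv homeo_fun;
  homeo_fun_continuous : continuous homeo_fun;
  homeo_inv_continuous : continuous homeo_inv }.

Lemma homeoP (f g : homeo) : f =1 g -> f = g.
Proof.
case: f g => [f f' fK f'K fc f'c] [g g' gK g'K gc g'c] /= fg.
have {}fg : f = g by exact/funext.
subst g; have {}fg' : f' = g'.
  by apply/funext => x; rewrite -[x in LHS]g'K fK.
by subst g'; congr Homeo; exact: Prop_irrelevance.
Qed.

HB.instance Definition _ := gen_eqMixin homeo.
HB.instance Definition _ := gen_choiceMixin homeo.

Definition homeo1 : homeo :=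
  @Homeo id id (fun=> erefl) (fun=> erefl) (fun=> cvg_id) (fun=> cvg_id).

Definition homeoV (f : homeo) : homeo :=
  Homeo (homeo_invK f) (homeo_funK f)
    (@homeo_inv_continuous f) (@homeo_fun_continuous f).

Definition homeoM (f g : homeo) : homeo :=
  Homeo (can_comp (homeo_funK f) (homeo_funK g))
    (can_comp (homeo_invK g) (homeo_invK f))
    (fun x => continuous_comp (@homeo_fun_continuous g x)
                              (@homeo_fun_continuous f (g x)))
    (fun x => continuous_comp (@homeo_inv_continuous f x)
                              (@homeo_inv_continuous g (homeo_inv f x))).

Fact homeoMA : associative homeoM. Proof. by move=> f g h; exact: homeoP. Qed.
Fact homeoM1 : right_id homeo1 homeoM. Proof. by move=> f; exact: homeoP. Qed.
Fact homeo1M : left_id homeo1 homeoM. Proof. by move=> f; exact: homeoP. Qed.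
Fact homeoVM : left_inverse homeo1 homeoV homeoM.
Proof. by move=> f; apply: homeoP => x; exact: (homeo_funK f). Qed.
Fact homeoMV : right_inverse homeo1 homeoV homeoM.
Proof. by move=> f; apply: homeoP => x; exact: (homeo_invK f). Qed.

HB.instance Definition _ :=
  isGroup.Build homeo homeoMA homeo1M homeoM1 homeoVM homeoMV.

End Homeomorphisms.

(* Common shape of the definitions of V, nV and V_G, used only to prove that
   they are closed under the group operations: E i is the parametrization of
   the piece C i, and L is the set of local maps. *)
Section Piecewise.
Context (T I : Type) (E : I -> T -> T) (C : I -> set T) (L : set (T -> T)).

Definition piecewise (f : T -> T) := exists m (e d : 'I_m -> I)
    (l : 'I_m -> T -> T),
  [/\ partition setT (C \o e) setT, partition setT (C \o d) setT,
      forall i, L (l i) & forall i x, f (E (e i) x) = E (d i) (l i x)].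

Hypothesis CE : forall i, C i = range (E i).
Variables (I1 : I) (Icat : I -> I -> I).
Hypothesis E1 : E I1 =1 id.
Hypothesis Ecat : forall i j x, E (Icat i j) x = E i (E j x).
Hypothesis Emeet : forall i j x y, E i x = E j y -> exists a b,
  (forall z, E i (E a z) = E j (E b z)) /\
  forall x' y', E i x' = E j y' -> exists z, x' = E a z /\ y' = E b z.
Hypothesis L1 : L id.
Hypothesis LM : forall k l, L k -> L l -> L (k \o l).
Hypothesis LV : forall l, L l -> exists k, [/\ L k, cancel l k & cancel k l].
Hypothesis LE : forall l i, L l -> exists j k, L k /\
  forall x, l (E i x) = E j (k x).

Lemma piecewise1 : piecewise id.
Proof.
have [[x _]|T0] := pselect (exists x : T, True).
  have P : partition [set: 'I_1] (fun=> C I1) setT.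
    split=> [||i _].
    - apply/seteqP; split=> // y _; exists ord0 => //.
      by rewrite CE; exists y; rewrite ?E1.
    - by move=> i j _ _ _; rewrite !ord1.
    - by rewrite CE; exists (E I1 x); exists x.
  by exists 1%N, (fun=> I1), (fun=> I1), (fun=> id); split.
have P : partition [set: 'I_0] (fun=> C I1) setT.
  split=> [||[]//]; last by move=> [].
  by apply/seteqP; split=> // y; case: T0; exists y.
by exists 0%N, (fun=> I1), (fun=> I1), (fun=> id); split=> // -[].
Qed.

Lemma piecewiseV f g : cancel f g -> piecewise f -> piecewise g.
Proof.
move=> fK [m [e [d [l [Pe Pd Ll fE]]]]].
pose k i := projT1 (cid (LV (Ll i))).
have kP i : [/\ L (k i), cancel (l i) (k i) & cancel (k i) (l i)].
  by rewrite /k; case: cid.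
exists m, d, e, k; split=> // [i|i x]; first by case: (kP i).
by case: (kP i) => _ _ kK; rewrite -{1}(kK x) -fE fK.
Qed.

Let piecewise_fin (f g : T -> T) (K : finType) (e d : K -> I)
    (l : K -> T -> T) : cancel f g -> cancel g f ->
  (forall x, exists k y, x = E (e k) y) ->
  (forall k k' y y', E (e k) y = E (e k') y' -> k = k') ->
  (K -> inhabited T) ->
  (forall k, L (l k)) ->
  (forall k x, f (E (e k) x) = E (d k) (l k x)) -> piecewise f.
Proof.
move=> fK gK e_cov e_inj T0 Ll fE.
exists #|K|, (e \o enum_val), (d \o enum_val), (l \o enum_val); split.
- split.
  + apply/seteqP; split=> // x _; have [k [y ->]] := e_cov x.
    exists (enum_rank k) => //; rewrite /= CE enum_rankK.
    by exists y.
  + move=> i j _ _ [x [/=]]; rewrite !CE => -[y _ <-] [z _ /esym/e_inj].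
    exact: enum_val_inj.
  + move=> i _; have [y] := T0 (enum_val i).
    by exists (E (e (enum_val i)) y); rewrite /= CE; exists y.
- split.
  + apply/seteqP; split=> // x _; have [k [y gx]] := e_cov (g x).
    exists (enum_rank k) => //; rewrite /= CE enum_rankK.
    by exists (l k y); rewrite // -fE -gx gK.
  + move=> i j _ _ [x [/=]]; rewrite !CE => -[y _ <-] [z _].
    have [i' [Li' _ iK]] := LV (Ll (enum_val i)).
    have [j' [Lj' _ jK]] := LV (Ll (enum_val j)).
    rewrite -(iK y) -(jK z) -!fE => /(can_inj fK)/esym/e_inj.
    exact: enum_val_inj.
  + move=> i _; have [y] := T0 (enum_val i).
    by exists (E (d (enum_val i)) y); rewrite /= CE; exists y.
- by move=> i; exact: Ll.
- by move=> i x; exact: fE.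
Qed.

Lemma piecewiseM f f' g g' : cancel f f' -> cancel f' f ->
  cancel g g' -> cancel g' g ->
  piecewise f -> piecewise g -> piecewise (g \o f).
Proof.
move=> fK f'K gK g'K [m [e [d [l [Pe Pd Ll fE]]]]].
move=> [m' [e' [d' [l' [Pe' Pd' Ll' gE]]]]].
pose meets (p : 'I_m * 'I_m') := exists x y, E (d p.1) x = E (e' p.2) y.
pose K := {p : 'I_m * 'I_m' | `[< meets p >]}.
have refine (k : K) : exists (s : I * I * (T -> T)), [/\ L s.2,
    (forall x, g (f (E s.1.1 x)) = E s.1.2 (s.2 x)),
    (forall x, exists y, E s.1.1 x = E (e (val k).1) y) ,
    (forall x, exists y, f (E s.1.1 x) = E (e' (val k).2) y) &
    forall x, (exists y, x = E (e (val k).1) y) ->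
      (exists y, f x = E (e' (val k).2) y) -> exists y, x = E s.1.1 y].
  case: k => -[i j] /= /asboolP[/= x0 [y0 /Emeet[a [b [ab abP]]]]].
  have [li [Lli lK liK]] := LV (Ll i).
  have [a' [h [Lh hE]]] := LE a Lli.
  have [h' [Lh' hK h'K]] := LV Lh.
  have [b' [k [Lk kE]]] := LE b (Ll' j).
  have fs x : f (E (Icat (e i) a') x) = E (e' j) (E b (h' x)).
    by rewrite Ecat fE -{1}(h'K x) -hE liK ab.
  exists (Icat (e i) a', Icat (d' j) b', k \o h'); split=> /=.
  - exact: LM.
  - by move=> x; rewrite fs gE kE Ecat.
  - by move=> x; exists (E a' x); rewrite Ecat.
  - by move=> x; exists (E b (h' x)).
  - move=> _ [y ->] [z]; rewrite fE => /abP[w [lw _]].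
    by exists (h w); rewrite Ecat -hE -lw lK.
have {refine}[s sP] := choice refine.
apply: (@piecewise_fin (g \o f) (f' \o g') K (fun k => (s k).1.1)
  (fun k => (s k).1.2) (fun k => (s k).2)).
- exact: can_comp.
- exact: can_comp.
- move=> x.
  have [i xi] : exists i, exists y, x = E (e i) y.
    case: Pe => cov _ _; have : [set: T] x by [].
    by rewrite -cov => -[i _ /=]; rewrite CE => -[y _ <-]; exists i, y.
  have [j xj] : exists j, exists y, f x = E (e' j) y.
    case: Pe' => cov _ _; have : [set: T] (f x) by [].
    by rewrite -cov => -[j _ /=]; rewrite CE => -[y _ <-]; exists j, y.
  have ijP : `[< meets (i, j) >].
    apply/asboolP; case: xi xj => [y ->] [z]; rewrite fE => yz.
    by exists (l i y), z.
  have [_ _ _ _ /(_ x xi xj) ?] := sP (exist _ (i, j) ijP).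
  by exists (exist _ (i, j) ijP).
- move=> k k' y y' kk'.
  have [_ _ /(_ y)[z1 k1] /(_ y)[z2 k2] _] := sP k.
  have [_ _ /(_ y')[z1' k1'] /(_ y')[z2' k2'] _] := sP k'.
  apply: val_inj; rewrite [val k]surjective_pairing [val k']surjective_pairing.
  congr pair.
    case: Pe => _ triv _; apply: triv => //; exists (E (s k).1.1 y).
    by rewrite /= !CE; split; [exists z1|exists z1'; rewrite // kk'].
  case: Pe' => _ triv _; apply: triv => //; exists (f (E (s k).1.1 y)).
  by rewrite /= !CE; split; [exists z2|exists z2'; rewrite // kk'].
- by case=> -[i j] /= /asboolP[x _]; exists.
- by move=> k; have [] := sP k.
- by move=> k x; have [_ + _ _ _] := sP k; apply.
Qed.

End Piecewise.

Section Sequences.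
Context (X : Type).

Definition prepend (w : seq X) (x : nat -> X) : nat -> X :=
  fun k => nth (x (k - size w)%N) w k.

Definition cylinder (w : seq X) : set (nat -> X) :=
  [set x | mkseq x (size w) = w].

Lemma prepend_nil x : prepend [::] x = x.
Proof. by apply/funext => k; rewrite /prepend nth_nil subn0. Qed.

Lemma prepend_cat v w x : prepend (v ++ w) x = prepend v (prepend w x).
Proof.
apply/funext => k; rewrite /prepend nth_cat size_cat subnDA.
by case: ltnP => // ?; [exact: set_nth_default | rewrite [RHS]nth_default].
Qed.

Lemma mkseq_prepend w x : mkseq (prepend w x) (size w) = w.
Proof.
case: w => // a w; apply: (@eq_from_nth _ a); rewrite size_mkseq// => i iw.
by rewrite nth_mkseq// /prepend; exact: set_nth_default.
Qed.

Lemma prepend_shift w x k : prepend w x (size w + k)%N = x k.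
Proof. by rewrite /prepend nth_default ?leq_addr// addKn. Qed.

Lemma cylinderE w : cylinder w = range (prepend w).
Proof.
apply/seteqP; split=> [x xw|_ [x _ <-]]; last exact: mkseq_prepend.
exists (fun k => x (size w + k)%N) => //; apply/funext => k.
rewrite /prepend; case: (ltnP k (size w)) => kw; last first.
  by rewrite nth_default// subnKC.
by rewrite -[X in nth _ X]xw nth_mkseq.
Qed.

Lemma prepend_meet v w x y : prepend v x = prepend w y -> exists a b,
  (forall u, prepend v (prepend a u) = prepend w (prepend b u)) /\
  forall x' y', prepend v x' = prepend w y' ->
    exists u, x' = prepend a u /\ y' = prepend b u.
Proof.
have aux v1 v2 x1 x2 : (size v1 <= size v2)%N ->
    prepend v1 x1 = prepend v2 x2 -> exists a, v2 = v1 ++ a.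
  move=> v12 eqx; exists (drop (size v1) v2).
  have p1 := mkseq_prepend v1 x1; have p2 := mkseq_prepend v2 x2.
  rewrite eqx in p1.
  have p : v1 = take (size v1) v2.
    by rewrite -[in RHS]p2 -map_take take_iota (minn_idPl v12) -/(mkseq _ _) p1.
  by rewrite -[in LHS](cat_take_drop (size v1) v2) -p.
have inj s : injective (prepend s).
  by move=> x1 x2 eqx; apply/funext => k; rewrite -(prepend_shift s x1) eqx prepend_shift.
move=> eqx; have [vw|/ltnW wv] := leqP (size v) (size w).
  have [a ->] := aux _ _ _ _ vw eqx; exists a, [::]; split=> [u|x' y'].
    by rewrite prepend_cat prepend_nil.
  by rewrite prepend_cat => /inj ->; exists y'; rewrite prepend_nil.
have [a ->] := aux _ _ _ _ wv (esym eqx); exists [::], a; split=> [u|x' y'].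
  by rewrite prepend_cat prepend_nil.
by rewrite prepend_cat => /inj <-; exists x'; rewrite prepend_nil.
Qed.

End Sequences.

Definition is_thompsonV (g : homeo cantor_space) :=
  exists m (w z : 'I_m -> seq bool),
  [/\ partition [set: 'I_m] (fun i => cylinder (w i)) [set: nat -> bool],
      partition [set: 'I_m] (fun i => cylinder (z i)) [set: nat -> bool] &
      forall i x, g (prepend (w i) x) = prepend (z i) x].

Definition thompsonV_pred : {pred homeo cantor_space} :=
  fun g => `[< is_thompsonV g >].

Lemma is_thompsonVE g :
  is_thompsonV g <-> piecewise (@prepend bool) (@cylinder bool) [set id] g.
Proof.
split=> [[m [w [z [Pw Pz gE]]]]|[m [w [z [l [Pw Pz l1 gE]]]]]].
  by exists m, w, z, (fun=> id); split.
by exists m, w, z; split=> // i x; rewrite gE (l1 i).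
Qed.

Section PiecewiseGroup.
Context (T : topologicalType) (I : Type) (E : I -> T -> T) (C : I -> set T).
Context (L : set (T -> T)) (I1 : I) (Icat : I -> I -> I).

Lemma piecewise_group (P : {pred homeo T}) :
  (forall g : homeo T, g \in P <-> piecewise E C L g) ->
  (forall i, C i = range (E i)) -> E I1 =1 id ->
  (forall i j x, E (Icat i j) x = E i (E j x)) ->
  (forall i j x y, E i x = E j y -> exists a b,
    (forall z, E i (E a z) = E j (E b z)) /\
    forall x' y', E i x' = E j y' -> exists z, x' = E a z /\ y' = E b z) ->
  L id -> (forall k l, L k -> L l -> L (k \o l)) ->
  (forall l, L l -> exists k, [/\ L k, cancel l k & cancel k l]) ->
  (forall l i, L l -> exists j k, L k /\
    forall x, l (E i x) = E j (k x)) ->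
  group_closed P.
Proof.
move=> PE CE E1 Ecat Emeet L1 LM LV LE; split.
  by apply/PE; exact: (piecewise1 CE E1 L1).
move=> f g /PE pf /PE pg; apply/PE.
apply: (@piecewiseM _ _ E C L CE Icat Ecat Emeet LM LV LE
  (g^-1)%g g f (f^-1)%g) => //.
- exact: homeo_invK.
- exact: homeo_funK.
- exact: homeo_funK.
- exact: homeo_invK.
- by apply: (piecewiseV LV) pg; exact: homeo_funK.
Qed.

End PiecewiseGroup.

Fact thompsonV_group : group_closed thompsonV_pred.
Proof.
apply: (@piecewise_group cantor_space _ (@prepend bool) (@cylinder bool) [set id]
  [::] (@cat bool)) => //.
- by move=> g; rewrite unfold_in; split=> [/asboolP|] /is_thompsonVE// ?;
    apply/asboolP.
- exact: cylinderE.
- exact: prepend_nil.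
- exact: prepend_cat.
- exact: prepend_meet.
- by move=> k l -> ->.
- by move=> l ->; exists id.
- by move=> l i ->; exists i, id.
Qed.

Record thompsonV := ThompsonV {
  thompsonV_val :> homeo cantor_space;
  _ : thompsonV_val \in thompsonV_pred }.

HB.instance Definition _ := [isSub for thompsonV_val].
HB.instance Definition _ := [Choice of thompsonV by <:].
HB.instance Definition _ :=
  SubChoice_isSubGroup.Build _ _ thompsonV thompsonV_group.

Section Brin.
Context (n : nat).

Definition cantor_cube := prod_topology (fun _ : 'I_n => cantor_space).

HB.instance Definition _ := Topological.on cantor_cube.

Definition brick (w : 'I_n -> seq bool) : set cantor_cube :=
  [set x | forall j, cylinder (w j) (x j)].

Definition prepend_brick (w : 'I_n -> seq bool) (x : cantor_cube) :
  cantor_cube := fun j => prepend (w j) (x j).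

Definition is_brinV (g : homeo cantor_cube) :=
  exists m (w z : 'I_m -> 'I_n -> seq bool),
  [/\ partition [set: 'I_m] (fun i => brick (w i)) [set: cantor_cube],
      partition [set: 'I_m] (fun i => brick (z i)) [set: cantor_cube] &
      forall i x, g (prepend_brick (w i) x) = prepend_brick (z i) x].

Definition brinV_pred : {pred homeo cantor_cube} := fun g => `[< is_brinV g >].

Lemma is_brinVE g :
  is_brinV g <-> piecewise prepend_brick brick [set id] g.
Proof.
split=> [[m [w [z [Pw Pz gE]]]]|[m [w [z [l [Pw Pz l1 gE]]]]]].
  by exists m, w, z, (fun=> id); split.
by exists m, w, z; split=> // i x; rewrite gE (l1 i).
Qed.

Fact brinV_group : group_closed brinV_pred.
Proof.
apply: (@piecewise_group cantor_cube _ prepend_brick brick [set id]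
  (fun=> [::]) (fun v w j => v j ++ w j)) => //.
- by move=> g; rewrite unfold_in; split=> [/asboolP|] /is_brinVE// ?;
    apply/asboolP.
- move=> w; apply/seteqP; split=> [x xw|_ [x _ <-] j]; last first.
    exact: mkseq_prepend.
  have /choice[y yE] : forall j, exists y, prepend (w j) y = x j.
    by move=> j; have := xw j; rewrite cylinderE => -[y _ <-]; exists y.
  by exists y => //; apply/funext.
- by move=> x; apply/funext => j; exact: prepend_nil.
- by move=> v w x; apply/funext => j; exact: prepend_cat.
- move=> v w x y vw.
  have /choice[a /choice[b ab]] j := prepend_meet (congr1 (@^~ j) vw).
  exists a, b; split=> [u|x' y' vw'].
    by apply/funext => j; have [+ _] := ab j; apply.
  have /choice[u uE] j : exists u, x' j = prepend (a j) u /\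
      y' j = prepend (b j) u.
    by have [_ +] := ab j; apply; exact: (congr1 (@^~ j) vw').
  by exists u; split; apply/funext => j; have [] := uE j.
- by move=> k l -> ->.
- by move=> l ->; exists id.
- by move=> l i ->; exists i, id.
Qed.

Record brinV := BrinV {
  brinV_val :> homeo cantor_cube;
  _ : brinV_val \in brinV_pred }.

HB.instance Definition _ := [isSub for brinV_val].
HB.instance Definition _ := [Choice of brinV by <:].
HB.instance Definition _ := SubChoice_isSubGroup.Build _ _ brinV brinV_group.

End Brin.

Record selfSimilarGroup (X : finType) := SelfSimilarGroup {
  ssg_group :> groupType;
  ssg_act : ssg_group -> seq X -> seq X;
  ssg_act1 : ssg_act 1%g =1 id;
  ssg_actM : forall g h, ssg_act (g * h)%g =1 ssg_act g \o ssg_act h;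
  ssg_faithful : injective ssg_act;
  ssg_self_similar : forall g x, exists h y,
    forall w, ssg_act g (x :: w) = y :: ssg_act h w }.

Section Nekrashevych.
Context (X : finType) (G : selfSimilarGroup X).

Definition sequence_space := prod_topology (fun _ : nat => discrete_topology X).

HB.instance Definition _ := Topological.on sequence_space.

(* Self-similarity makes g act on words preserving length and prefixes, so the
   image of a sequence is the limit of the images of its finite prefixes; the
   default value of nth is never reached. *)
Definition ssg_boundary (g : G) (x : nat -> X) : nat -> X :=
  fun k => nth (x k) (ssg_act g (mkseq x k.+1)) k.

Definition is_nekrashevychV (f : homeo sequence_space) :=
  exists m (w z : 'I_m -> seq X) (g : 'I_m -> G),
  [/\ partition [set: 'I_m] (fun i => cylinder (w i)) [set: nat -> X],
      partition [set: 'I_m] (fun i => cylinder (z i)) [set: nat -> X] &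
      forall i x,
        f (prepend (w i) x) = prepend (z i) (ssg_boundary (g i) x)].

Definition nekrashevychV_pred : {pred homeo sequence_space} :=
  fun f => `[< is_nekrashevychV f >].

Lemma is_nekrashevychVE f : is_nekrashevychV f <->
  piecewise (@prepend X) (@cylinder X) (range ssg_boundary) f.
Proof.
split=> [[m [w [z [g [Pw Pz gE]]]]]|[m [w [z [l [Pw Pz lG lE]]]]]].
  by exists m, w, z, (ssg_boundary \o g); split=> // i; exists (g i).
have /choice[g gE] i : exists g, ssg_boundary g = l i.
  by have [g _ <-] := lG i; exists g.
by exists m, w, z, g; split=> // i x; rewrite lE gE.
Qed.

Lemma ssg_boundary1 : ssg_boundary 1%g = id.
Proof.
by apply/funext => x; apply/funext => k; rewrite /ssg_boundary ssg_act1 nth_mkseq.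
Qed.

Lemma ssg_boundary_cons g h a b x :
  (forall w, ssg_act g (a :: w) = b :: ssg_act h w) ->
  ssg_boundary g (prepend [:: a] x) = prepend [:: b] (ssg_boundary h x).
Proof.
move=> gh; apply/funext => k; rewrite /ssg_boundary.
have -> : mkseq (prepend [:: a] x) k.+1 = a :: mkseq x k.
  rewrite /mkseq /= -[1%N]addn0 iotaDl -map_comp; congr cons.
  by apply: eq_map => i; rewrite /= /prepend/= nth_nil subn1.
rewrite gh; case: k => // k.
by rewrite /prepend /= !nth_nil subn1.
Qed.

Lemma prepend_head (x : nat -> X) : x = prepend [:: x 0%N] (x \o succn).
Proof. by apply/funext => -[|k]//; rewrite /prepend/= nth_nil subn1. Qed.

Lemma ssg_boundaryM g h :
  ssg_boundary (g * h)%g = ssg_boundary g \o ssg_boundary h.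
Proof.
apply/funext => x; apply/funext => k /=; elim: k g h x => [|k IH] g h x.
all: have [h' [b hE]] := ssg_self_similar h (x 0%N).
all: have [g' [c gE]] := ssg_self_similar g b.
all: have ghE w : ssg_act (g * h)%g (x 0%N :: w) = c :: ssg_act (g' * h')%g w
  by rewrite !ssg_actM /= hE gE.
all: rewrite [x in LHS]prepend_head [x in RHS]prepend_head.
all: rewrite (ssg_boundary_cons _ ghE) (ssg_boundary_cons _ hE).
all: rewrite (ssg_boundary_cons _ gE) //.
by rewrite /prepend/= !nth_nil !subn1; exact: IH.
Qed.

Fact nekrashevychV_group : group_closed nekrashevychV_pred.
Proof.
apply: (@piecewise_group sequence_space _ (@prepend X) (@cylinder X) (range ssg_boundary)
  [::] (@cat X)).
- by move=> g; rewrite unfold_in; split=> [/asboolP|] /is_nekrashevychVE// ?;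
    apply/asboolP.
- exact: cylinderE.
- exact: prepend_nil.
- exact: prepend_cat.
- exact: prepend_meet.
- by exists 1%g => //; exact: ssg_boundary1.
- by move=> _ _ [g _ <-] [h _ <-]; exists (g * h)%g => //; exact: ssg_boundaryM.
- move=> _ [g _ <-]; exists (ssg_boundary g^-1%g); split; first by exists g^-1%g.
    by move=> x; have := ssg_boundaryM g^-1%g g; rewrite mulVg ssg_boundary1
      => /(congr1 (@^~ x)) /= <-.
  by move=> x; have := ssg_boundaryM g g^-1%g; rewrite mulgV ssg_boundary1
    => /(congr1 (@^~ x)) /= <-.
- move=> _ w [g _ <-]; elim: w g => [|a w IH] g.
    exists [::], (ssg_boundary g); split; first by exists g.
    by move=> x; rewrite !prepend_nil.
  have [h [b gh]] := ssg_self_similar g a.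
  have [z [k [Lk kE]]] := IH h; exists (b :: z), k; split=> // x.
  by rewrite -cat1s prepend_cat (ssg_boundary_cons _ gh) kE -prepend_cat.
Qed.

Record nekrashevychV := NekrashevychV {
  nekrashevychV_val :> homeo sequence_space;
  _ : nekrashevychV_val \in nekrashevychV_pred }.

HB.instance Definition _ := [isSub for nekrashevychV_val].
HB.instance Definition _ := [Choice of nekrashevychV by <:].
HB.instance Definition _ :=
  SubChoice_isSubGroup.Build _ _ nekrashevychV nekrashevychV_group.

End Nekrashevych.

Arguments Cstar_simple R G : clear implicits.

(* Main.v *)
From HB Require Import structures.
From mathcomp Require Import all_boot all_order all_algebra.
From mathcomp Require Import boolp classical_sets functions.
From mathcomp Require Import cardinality fsbigop reals ereal.
From mathcomp Require Import topology esum cantor.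
From mathcomp Require Import complex ring lra.
From mathcomp Require finmap.
Require Import Defs.

(** Let G act faithfully by homeomorphisms on a Hausdorff space so that
inside every nonempty open set there are arbitrarily many elements of G,
supported on a common nonempty subset V, that play ping-pong on V. Then G is
C*-simple, by Powers' averaging method.

First, simplicity follows once finitely many translations by elements t <> 1
can be made small in norm by one and the same average of conjugates
([Cstar_simple_of_averaging]): a nonzero element of an ideal, after a
translation, has a nonzero coefficient at the identity, and averaging it
produces elements of the ideal arbitrarily close to a nonzero scalar.

Next, such an average exists ([simultaneous_average]). The action need not be
topologically free, so in general no point is moved by all the given
elements. But the first one moves some point, and by shrinking a
neighbourhood of it one reaches a nonempty open set U such that every given t
either fixes U pointwise or moves U off itself. Conjugation by elements
supported in U does not change a t of the first kind. If t is of the second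
kind and s is supported on V inside U, then s t s^-1 t^-1 acts on V as s; so
if s runs through k elements that play ping-pong on V, the average of the
conjugates s t s^-1 has norm at most 2 / sqrt k ([ping_pong_sqnorm],
[displaced_average_sqnorm]). The elements fixing U form a shorter list of
elements of the original form, and induction treats them.

Finally, in V, nV and V_G the ping-pong elements are explicit. For a finite
word (or tuple of words) w, there is an involution exchanging the complement
of the brick of w with its copy inside this brick, and fixing the rest; it
maps the complement into the brick, so the exchanges along disjoint bricks
play ping-pong. Copied into a brick v, they are supported there, and they lie
in all three kinds of groups since they only replace prefixes
([Cstar_simple_of_brickwise]). *)

Set Implicit Arguments.
Unset Strict Implicit.
Unset Printing Implicit Defensive.

Import Order.TTheory GRing.Theory Num.Theory.
Import Normc.

Local Open Scope classical_set_scope.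
Local Open Scope ring_scope.

(** * Finite and infinite sums *)

Section SumLemmas.
Context (R : realType).

Lemma esumZ (I : choiceType) (c : R) (f : I -> R) : 0 <= c ->
  (forall i, 0 <= f i) ->
  (\esum_(i in [set: I]) (c * f i)%:E =
   c%:E * \esum_(i in [set: I]) (f i)%:E)%E.
Proof.
have le d (h : I -> R) : 0 <= d -> (forall i, 0 <= h i) ->
    (\esum_(i in [set: I]) (d * h i)%:E <=
     d%:E * \esum_(i in [set: I]) (h i)%:E)%E.
  move=> d0 h0; apply: ge_ereal_sup => _ [A [finA _] <-].
  apply: (@le_trans _ _ (d%:E * \sum_(x \in A) (h x)%:E)%E).
    by rewrite ge0_mule_fsumr// => g; rewrite lee_fin.
  apply: lee_wpmul2l; first by rewrite lee_fin.
  by apply: ereal_sup_ubound; exists A.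
move=> c0 f0; have [->|cn0] := eqVneq c 0.
  by rewrite mul0e esum1// => i _; rewrite mul0r.
apply/eqP; rewrite eq_le le//=.
have := le c^-1 (fun i => c * f i); rewrite invr_ge0 => /(_ c0) /(_ _) lec.
have cf : (fun i => (c^-1 * (c * f i))%:E) = fun i => (f i)%:E.
  by apply/funext => i; rewrite mulKf.
rewrite cf in lec.
rewrite -[leRHS]mul1e -(mulfV cn0) EFinM -muleA lee_wpmul2l ?lee_fin//.
by apply: lec => i; rewrite mulr_ge0.
Qed.

Lemma sqr_sum_le (I : Type) (s : seq I) (f : I -> R) :
  (\sum_(i <- s) f i) ^+ 2 <= (size s)%:R * \sum_(i <- s) f i ^+ 2.
Proof.
elim: s => [|i s IH]; first by rewrite !big_nil expr0n/= mul0r.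
rewrite !big_cons /= -natr1.
set S := \sum_(j <- s) f j in IH *; set Q := \sum_(j <- s) _ in IH *.
have Q0 : 0 <= Q by apply: sumr_ge0 => j _; exact: sqr_ge0.
have : 0 <= (size s)%:R :> R by exact: ler0n.
move: (size s)%:R IH => n IH; rewrite le_eqVlt => /predU1P[n0|n0].
  have S0 : S = 0.
    by apply/eqP; rewrite -sqrf_eq0 eq_le sqr_ge0 (le_trans IH)// -n0 mul0r.
  by rewrite S0 -n0; nra.
set x := f i; have : 0 <= n * (n * x ^+ 2 + Q - 2 * x * S).
  by have := sqr_ge0 (n * x - S); nra.
by rewrite pmulr_rge0//; nra.
Qed.

Lemma normc_ge0 (z : R[i]) : 0 <= normc z.
Proof. by case: z => x y; exact: sqrtr_ge0. Qed.

Lemma normc_sqr_sum_le (I : Type) (s : seq I) (z : I -> R[i]) :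
  normc (\sum_(i <- s) z i) ^+ 2 <=
  (size s)%:R * \sum_(i <- s) normc (z i) ^+ 2.
Proof.
apply: le_trans (sqr_sum_le _ _).
rewrite ler_sqr ?nnegrE ?normc_ge0 ?sumr_ge0// => [|i _]; last exact: normc_ge0.
elim/big_ind2 : _ => [|x y x' y' hx hy|//]; first by rewrite normc0.
by apply: le_trans (le_normcD _ _) _; exact: lerD.
Qed.

End SumLemmas.

(** * The squared norm of ell2 *)

Section SquaredNorm.
Context (R : realType) (G : groupType).
Implicit Types (u v w : ell2 R G) (S T : ell2 R G -> ell2 R G).

(** The whole proof works with squared norms, where each estimate reduces to
an inequality between coordinates. The constants lost in this way, as in
[sqnormD], are harmless: every quantity that matters can be made arbitrarily
small. *)
Definition sqnorm v : R :=
  fine (\esum_(g in [set: G]) (normc (v g) ^+ 2)%:E)%E.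

Lemma sqnormE v :
  (sqnorm v)%:E = (\esum_(g in [set: G]) (normc (v g) ^+ 2)%:E)%E.
Proof.
rewrite fineK// ge0_fin_numE; first by have := valP v; rewrite unfold_in.
by apply: esum_ge0 => g _; rewrite lee_fin sqr_ge0.
Qed.

Lemma sqnorm_ge0 v : 0 <= sqnorm v.
Proof.
by rewrite -lee_fin sqnormE esum_ge0// => g _; rewrite lee_fin sqr_ge0.
Qed.

Lemma sqnorm_sum (I : choiceType) (s : seq I) (c : I -> R) (w : I -> ell2 R G) :
  (forall i, 0 <= c i) ->
  ((\sum_(i <- s) c i * sqnorm (w i))%:E =
  \esum_(g in [set: G]) (\sum_(i <- s) c i * normc (w i g) ^+ 2)%:E)%E.
Proof.
move=> c0; rewrite (eq_esum (b := fun g =>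
   (\sum_(i <- s) (c i * normc (w i g) ^+ 2)%:E)%E)); last first.
  by move=> g _; rewrite sumEFin.
rewrite esum_sum; last first.
  by move=> g i _ _; rewrite lee_fin mulr_ge0// sqr_ge0.
rewrite -sumEFin; apply: eq_bigr => i _.
by rewrite esumZ// => [|g]; rewrite ?sqr_ge0// EFinM sqnormE.
Qed.

(** This transfers a coordinatewise inequality to squared norms; both sides
are weighted sums so that it covers convexity as well as orthogonality. *)
Lemma ler_sqnorm_sum (I J : choiceType) (r : seq I) (s : seq J) (c : I -> R)
    (d : J -> R) (u : I -> ell2 R G) (w : J -> ell2 R G) :
  (forall i, 0 <= c i) -> (forall j, 0 <= d j) ->
  (forall g, \sum_(i <- r) c i * normc (u i g) ^+ 2 <=
     \sum_(j <- s) d j * normc (w j g) ^+ 2) ->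
  \sum_(i <- r) c i * sqnorm (u i) <= \sum_(j <- s) d j * sqnorm (w j).
Proof.
move=> c0 d0 cd; rewrite -lee_fin !sqnorm_sum//.
by apply: le_esum => g _; rewrite lee_fin.
Qed.

Lemma ell2D u v g : (u + v) g = u g + v g. Proof. by []. Qed.
Lemma ell2Z (a : R[i]) v g : (a *: v) g = a * v g. Proof. by []. Qed.
Lemma ell2N v g : (- v) g = - v g. Proof. by []. Qed.
Lemma ell2_sum (I : Type) (s : seq I) (w : I -> ell2 R G) g :
  (\sum_(i <- s) w i) g = \sum_(i <- s) w i g.
Proof. by elim/big_rec2 : _ => // i x y _ <-. Qed.

Lemma ell2P u v : (forall g, u g = v g) -> u = v.
Proof. by move=> uv; apply: val_inj; apply/funext => g; exact: uv. Qed.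

Lemma sqnorm_sum_le (I : Type) (s : seq I) (w : I -> ell2 R G) :
  sqnorm (\sum_(i <- s) w i) <= (size s)%:R * \sum_(i <- s) sqnorm (w i).
Proof.
rewrite -(big_map w xpredT id) -(big_map w xpredT (@sqnorm)) -(size_map w).
move: (map w s) => r; rewrite mulr_sumr.
have := @ler_sqnorm_sum unit _ [:: tt] r (fun=> 1) (fun=> (size r)%:R)
  (fun=> \sum_(v <- r) v) id.
rewrite big_seq1 mul1r; apply => // g.
rewrite big_seq1 mul1r ell2_sum -mulr_sumr.
exact: normc_sqr_sum_le.
Qed.

Lemma sqnormZ a v : sqnorm (a *: v) = normc a ^+ 2 * sqnorm v.
Proof.
apply: EFin_inj; rewrite sqnormE EFinM sqnormE -esumZ ?sqr_ge0// => [|g].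
  by apply: eq_esum => g _; rewrite ell2Z normcM exprMn.
exact: sqr_ge0.
Qed.

Lemma sqnorm_lregular g v : sqnorm (lregular g v) = sqnorm v.
Proof.
rewrite /sqnorm; congr fine.
rewrite [RHS](reindex_esum [set: G] _ (fun h => (g^-1 * h)%g))//.
split=> [//|x y _ _ /mulgI //|y _ /=].
by exists (g * y)%g => //; rewrite mulKg.
Qed.

Lemma normc_le_sqnorm v g : normc (v g) ^+ 2 <= sqnorm v.
Proof.
rewrite -lee_fin sqnormE; apply: esum_ge; exists [set g].
  by split => //; exact: finite_set1.
by rewrite fsbig_set1.
Qed.

Lemma sqnorm_eq0 v : sqnorm v = 0 -> v = 0.
Proof.
move=> v0; apply: ell2P => g; apply: eq0_normc; apply/eqP.
by rewrite -sqrf_eq0 eq_le sqr_ge0 andbT -v0 normc_le_sqnorm.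
Qed.

Fact restrict_square_summable (A : set G) v :
  (fun g => if g \in A then v g else 0 : (R[i])^o) \in @square_summable R G.
Proof.
have := valP v; rewrite !unfold_in /square_summable; apply: le_lt_trans.
apply: le_esum => g _; rewrite lee_fin; case: (g \in A) => //.
by rewrite normc0 expr0n sqr_ge0.
Qed.

Definition restrict_ell2 A v : ell2 R G := Ell2 (restrict_square_summable A v).

Lemma restrict_ell2E A v g :
  restrict_ell2 A v g = if g \in A then v g else 0.
Proof. by []. Qed.

Lemma delta_square_summable (h : G) :
  (fun g => (g == h)%:R : (R[i])^o) \in @square_summable R G.
Proof.
rewrite unfold_in /square_summable (eq_esum (b :=
    fun g => if g \in [set h] then 1%E else 0%E)).
  by rewrite -esum_mkcond esum_set1// ltry.
move=> g _; case: eqP => [->|gh]; first by rewrite mem_set// normc1 expr1n.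
by rewrite memNset// normc0 expr0n.
Qed.

Definition delta h : ell2 R G := Ell2 (delta_square_summable h).

Lemma sqnorm_delta h : sqnorm (delta h) = 1.
Proof.
apply: EFin_inj; rewrite sqnormE (eq_esum (b :=
    fun g => if g \in [set h] then 1%E else 0%E)).
  by rewrite -esum_mkcond esum_set1.
move=> g _ /=; case: eqP => [->|gh]; first by rewrite mem_set// normc1 expr1n.
by rewrite memNset// normc0 expr0n.
Qed.

End SquaredNorm.

(** * Ping-pong, translations and averages of conjugates *)

Section Operators.
Context (R : realType) (G : groupType).
Implicit Types (u v w : ell2 R G) (S T : ell2 R G -> ell2 R G) (m : R).

Lemma sqnormD u v : sqnorm (u + v) <= 2 * (sqnorm u + sqnorm v).
Proof.
have := sqnorm_sum_le [:: u; v] id.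
by rewrite !big_cons !big_nil !addr0.
Qed.

(** Orthogonality of vectors with disjoint supports. *)
Lemma sqnorm_sum_disjoint k (u : 'I_k -> ell2 R G) :
  (forall g i j, u i g != 0 -> u j g != 0 -> i = j) ->
  sqnorm (\sum_i u i) <= \sum_i sqnorm (u i).
Proof.
move=> disj.
have <- : \sum_i 1 * sqnorm (u i) = \sum_i sqnorm (u i).
  by apply: eq_bigr => i _; rewrite mul1r.
have := @ler_sqnorm_sum R G unit _ [:: tt] (index_enum 'I_k) (fun=> 1) (fun=> 1)
  (fun=> \sum_i u i) u.
rewrite big_seq1 mul1r; apply => // g; rewrite big_seq1 mul1r ell2_sum.
have [/existsP[i ui]|/existsPn u0] := boolP [exists i, u i g != 0].
  have uj j : j != i -> u j g = 0.
    by move=> ji; apply/eqP/negP => /negP /disj/(_ ui)/eqP; rewrite (negbTE ji).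
  rewrite (bigD1 i)//= [X in _ + X]big1 ?addr0//.
  rewrite (bigD1 i)//= mul1r lerDl sumr_ge0// => j _.
  by rewrite mul1r sqr_ge0.
rewrite big1 => [|i _]; last by apply/eqP; have := u0 i; rewrite negbK.
by rewrite normc0 expr0n sumr_ge0// => i _; rewrite mul1r sqr_ge0.
Qed.

Lemma sqnorm_restrict_disjoint k (E : 'I_k -> set G) v :
  trivIset setT E ->
  \sum_i sqnorm (restrict_ell2 (E i) v) <= sqnorm v.
Proof.
move=> disj.
have <- : \sum_i 1 * sqnorm (restrict_ell2 (E i) v) =
    \sum_i sqnorm (restrict_ell2 (E i) v).
  by apply: eq_bigr => i _; rewrite mul1r.
have := @ler_sqnorm_sum R G _ unit (index_enum 'I_k) [:: tt] (fun=> 1) (fun=> 1)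
  (fun i => restrict_ell2 (E i) v) (fun=> v).
rewrite big_seq1 mul1r; apply => // g; rewrite big_seq1 mul1r.
have [/existsP[i ui]|/existsPn u0] := boolP [exists i, g \in E i].
  rewrite (bigD1 i)//= [X in _ + X]big1 ?addr0 ?mul1r.
    by rewrite ui.
  move=> j ji; rewrite mul1r memNset ?normc0 ?expr0n// => gj.
  have /eqP := disj j i I I (ex_intro _ g (conj gj (set_mem ui))).
  by rewrite (negbTE ji).
rewrite big1 ?sqr_ge0// => i _; rewrite mul1r /=.
by rewrite (negbTE (u0 i)) normc0 expr0n.
Qed.

(** Powers' estimate. The triangle inequality only bounds the norm of a sum
of k translations by k, but ping-pong brings it down to the order of the
square root of k: the parts of the translates that lie in the disjoint sets D
i are orthogonal, and the remaining parts are translates of the restrictions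
of v to the sets E i of the points that h i throws out of D i, which are
contained in the D i and hence disjoint too. *)
Lemma ping_pong_sqnorm k (h : 'I_k -> G) (D : 'I_k -> set G) v :
  trivIset setT D -> (forall i g, ~ D i (h i * g)%g -> D i g) ->
  sqnorm (\sum_i lregular (h i) v) <= 4 * k%:R * sqnorm v.
Proof.
move=> disj hD.
pose E i : set G := [set g | ~ D i (h i * g)%g].
pose A i := restrict_ell2 (D i) (lregular (h i) v).
pose B i := lregular (h i) (restrict_ell2 (E i) v).
have -> : \sum_i lregular (h i) v = \sum_i A i + \sum_i B i.
  rewrite -big_split; apply: eq_bigr => i _; apply: ell2P => g.
  rewrite ell2D [RHS]/=; have [gD|gD] := boolP (g \in D i).
    rewrite memNset ?addr0//= => /(_ _); rewrite mulVKg; apply; exact: set_mem.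
  rewrite mem_set ?add0r//= => Dg; move/negP: gD; apply.
  by rewrite mulVKg in Dg; rewrite inE.
have SA : sqnorm (\sum_i A i) <= k%:R * sqnorm v.
  apply: (@le_trans _ _ (\sum_i sqnorm (A i))).
    apply: sqnorm_sum_disjoint => g i j /=.
    case: ifPn => [/set_mem gi _|]; last by rewrite eqxx.
    case: ifPn => [/set_mem gj _|]; last by rewrite eqxx.
    by apply: (disj i j I I); exists g.
  apply: (@le_trans _ _ (\sum_(i < k) sqnorm v)); last first.
    by rewrite sumr_const card_ord mulr_natl.
  apply: ler_sum => i _; rewrite -[leRHS](sqnorm_lregular (h i)).
  have := @sqnorm_restrict_disjoint 1 (fun=> D i) (lregular (h i) v).
  by rewrite big_ord1; apply => ? ? _ _ _; rewrite !ord1.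
have SB : sqnorm (\sum_i B i) <= k%:R * sqnorm v.
  apply: le_trans (sqnorm_sum_le _ _) _.
  rewrite [X in X%:R](_ : _ = k); last first.
    by rewrite -[RHS](card_ord k) cardE enumT.
  rewrite ler_wpM2l//; under eq_bigr do rewrite sqnorm_lregular.
  apply: sqnorm_restrict_disjoint => i j _ _ [g [/= gi gj]].
  by apply: (disj i j I I); exists g; split; exact: hD.
apply: le_trans (sqnormD _ _) _; lra.
Qed.

(** For linear T, this bounds the square of the operator norm by m. *)
Definition op_sqbound T m := forall v, sqnorm (T v) <= m * sqnorm v.

Lemma op_norm_leP T M : 0 <= M -> op_norm_le T M <-> op_sqbound T (M ^+ 2).
Proof.
move=> M0; split=> TM v; have := TM v.
  rewrite /ell2_norm -/(sqnorm _) -/(sqnorm _) => /(fun h => (lerXn2r 2 _ _ h)).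
  rewrite exprMn !sqr_sqrtr ?sqnorm_ge0//; apply; rewrite nnegrE ?sqrtr_ge0//.
  by rewrite mulr_ge0// sqrtr_ge0.
rewrite /ell2_norm -/(sqnorm _) -/(sqnorm _) => TMv.
by rewrite -[X in X * _](ger0_norm M0) -sqrtr_sqr -sqrtrM ?sqr_ge0// ler_wsqrtr.
Qed.

Lemma lregularM g h v : lregular (g * h)%g v = lregular g (lregular h v).
Proof. by apply: ell2P => x /=; rewrite invgM mulgA. Qed.

Lemma lregular1 v : lregular 1%g v = v.
Proof. by apply: ell2P => x /=; rewrite invg1 mul1g. Qed.

Lemma lregular_linear g : linear (@lregular R G g).
Proof. by move=> a u v; apply: ell2P. Qed.

HB.instance Definition _ g := GRing.isLinear.Build R[i] (ell2 R G) (ell2 R G) _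
  (@lregular R G g) (lregular_linear g).

Lemma lregular_delta (g h : G) : lregular g (delta R h) = delta R (g * h)%g.
Proof.
apply: ell2P => x /=; congr (nat_of_bool _)%:R.
by apply/eqP/eqP => [<-|->]; rewrite ?mulVKg ?mulKg.
Qed.

Lemma op_sqbound_le T m m' : m <= m' -> op_sqbound T m -> op_sqbound T m'.
Proof.
by move=> mm' Tm v; apply: le_trans (Tm v) _; rewrite ler_wpM2r ?sqnorm_ge0.
Qed.

Lemma op_sqbound_lregular g : op_sqbound (lregular g) 1.
Proof. by move=> v; rewrite sqnorm_lregular mul1r. Qed.

Lemma op_sqboundD S T m m' :
  op_sqbound S m -> op_sqbound T m' -> op_sqbound (S + T) (2 * (m + m')).
Proof.
move=> Sm Tm v; apply: le_trans (sqnormD _ _) _.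
by have := Sm v; have := Tm v; lra.
Qed.

Lemma op_sqboundZ T m a :
  op_sqbound T m -> op_sqbound (a *: T) (normc a ^+ 2 * m).
Proof.
by move=> Tm v; rewrite sqnormZ -[leRHS]mulrA ler_wpM2l ?sqr_ge0 ?Tm.
Qed.

Lemma lregular_reduced g : reduced_Cstar_algebra (@lregular R G g).
Proof.
split.
  split; first exact: lregular_linear.
  exists 1; apply/op_norm_leP => //; rewrite expr1n; exact: op_sqbound_lregular.
move=> e e0; exists (lregular g).
  by exists [:: (1, g)]; rewrite big_seq1 scale1r.
rewrite subrr; apply/op_norm_leP; first exact: ltW.
move=> v; have -> : (0 : ell2 R G -> ell2 R G) v = 0 *: v by rewrite scale0r.
rewrite sqnormZ normc0 expr0n mul0r.
by rewrite mulr_ge0 ?sqr_ge0 ?sqnorm_ge0.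
Qed.

Definition conj_avg (s : seq G) T : ell2 R G -> ell2 R G :=
  (size s)%:R^-1 *: \sum_(g <- s) (lregular g \o T \o lregular g^-1%g).

(** The properties shared by all composites of averages of conjugates. They
are exactly what is used of an average, and the last one holds because an
ideal is stable under multiplication by the left translations. *)
Record averaging (Phi : (ell2 R G -> ell2 R G) -> (ell2 R G -> ell2 R G)) := {
  averaging_linear : linear Phi;
  averaging_id : Phi id = id;
  averaging_sqbound : forall T m, op_sqbound T m -> op_sqbound (Phi T) m;
  averaging_ideal : forall J,
    closed_two_sided_ideal (@reduced_Cstar_algebra R G) J ->
    forall T, J T -> J (Phi T) }.

Lemma averaging_comp Phi Psi :
  averaging Phi -> averaging Psi -> averaging (Phi \o Psi).
Proof.
move=> [lP iP bP jP] [lQ iQ bQ jQ]; split=> [a S T||T m /bQ/bP//|J JI T].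
- by rewrite /= lQ lP.
- by rewrite /= iQ iP.
- by move=> /(jQ _ JI)/(jP _ JI).
Qed.

Lemma conj_avgE s T v : conj_avg s T v =
  (size s)%:R^-1 *: \sum_(g <- s) lregular g (T (lregular g^-1%g v)).
Proof.
rewrite /conj_avg /GRing.scale/=; congr (_ *: _).
by elim/big_rec2 : _ => // g x S _ <-.
Qed.

Lemma normc_natV (k : nat) : normc (k%:R^-1 : R[i]) = k%:R^-1.
Proof.
rewrite normcV; congr _^-1.
by rewrite normcMn normc1.
Qed.

(** The bound is preserved because conjugation by a translation is isometric
and the squared norm is convex. *)
Lemma averaging_conj (s : seq G) : (0 < size s)%N -> averaging (conj_avg s).
Proof.
move=> s0; have n0 : (size s)%:R != 0 :> R[i] by rewrite pnatr_eq0 -lt0n.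
have r0 : (size s)%:R != 0 :> R by rewrite pnatr_eq0 -lt0n.
split=> [a S T||T m Tm v|J [JA J0 JL JM JC] T JT].
- apply/funext => v.
  rewrite -[RHS]/(a *: conj_avg s S v + conj_avg s T v) !conj_avgE.
  rewrite scalerA mulrC -scalerA -scalerDr; congr (_ *: _).
  rewrite scaler_sumr -big_split; apply: eq_bigr => g _ /=.
  by rewrite -linearP.
- apply/funext => v; rewrite conj_avgE.
  under eq_bigr do rewrite -lregularM mulgV lregular1.
  rewrite big_const_seq count_predT iter_addr_0 -(scaler_nat _ v).
  by rewrite scalerA mulVf ?scale1r.
- rewrite conj_avgE sqnormZ normc_natV.
  apply: (@le_trans _ _ ((size s)%:R^-1 ^+ 2 *
      ((size s)%:R * \sum_(g <- s) m * sqnorm v))).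
    rewrite ler_wpM2l ?sqr_ge0//; apply: le_trans (sqnorm_sum_le _ _) _.
    rewrite ler_wpM2l//; apply: ler_sum => g _; rewrite sqnorm_lregular.
    by apply: le_trans (Tm _) _; rewrite sqnorm_lregular.
  rewrite big_const_seq count_predT iter_addr_0 -(mulr_natl _ (size s)).
  by rewrite le_eqVlt; apply/orP; left; apply/eqP; field.
- rewrite /conj_avg -[X in J X]addr0; apply: (JL) => //.
  elim: s {s0 n0 r0} => [|g s IH]; first by rewrite big_nil.
  rewrite big_cons -[X in J (X + _)]scale1r; apply: (JL) => //.
  apply: (JM _ _ (lregular_reduced _) _).2.
  exact: (JM _ _ (lregular_reduced _) JT).1.
Qed.

End Operators.

(** * From averages to simplicity *)

Section Density.
Context (R : realType) (G : groupType).
Implicit Types (v : ell2 R G) (S T : ell2 R G -> ell2 R G).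

Lemma sqnorm_tail v (e : R) : 0 < e ->
  exists2 A : set G, finite_set A & sqnorm (v - restrict_ell2 A v) <= e.
Proof.
move=> e0; pose f g := (normc (v g) ^+ 2)%:E.
have fin : (\esum_(g in [set: G]) f g)%E \is a fin_num by rewrite -sqnormE.
have [_ [A [finA _] <-]] := ub_ereal_sup_adherent e0 fin.
rewrite -/(esum _ _) -sqnormE => sA; exists A => //.
have : sqnorm v = sqnorm (restrict_ell2 A v) + sqnorm (v - restrict_ell2 A v).
  apply: EFin_inj; rewrite EFinD !sqnormE -esumD => [|g _|g _].
  - apply: eq_esum => g _; rewrite ell2D ell2N /= -EFinD; congr EFin.
    by case: ifP => _; rewrite ?subrr ?subr0 normc0 expr0n ?addr0 ?add0r.
  - by rewrite lee_fin sqr_ge0.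
  - by rewrite lee_fin sqr_ge0.
have : (\sum_(g \in A) f g <= (sqnorm (restrict_ell2 A v))%:E)%E.
  rewrite sqnormE; apply: esum_ge; exists A => //.
  rewrite le_eqVlt; apply/orP; left; apply/eqP/eq_fsbigr => g gA /=.
  by rewrite gA.
move=> /(lt_le_trans sA); rewrite -EFinB lte_fin; lra.
Qed.

Lemma restrict_finite (A : set G) v : finite_set A ->
  restrict_ell2 A v = \sum_(h <- finmap.enum_fset (fset_set A)) v h *: delta R h.
Proof.
move=> finA; apply: ell2P => g; rewrite ell2_sum restrict_ell2E.
case: ifPn => gA; last first.
  rewrite big_seq big1// => h; rewrite in_fset_set// => hA.
  rewrite ell2Z /=; case: eqP => [gh|_]; last by rewrite mulr0.
  by rewrite gh hA in gA.
rewrite (bigD1_seq g) ?finmap.fset_uniq ?in_fset_set//.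
rewrite big1 => [|h hg]; first by rewrite [RHS]addr0 ell2Z /= eqxx mulr1.
by rewrite ell2Z /= eq_sym (negbTE hg) mulr0.
Qed.

(** The finitely supported vectors are dense by [sqnorm_tail]. *)
Lemma operator_eq0 T m : linear T -> op_sqbound T m ->
  (forall h, T (delta R h) = 0) -> T = 0.
Proof.
move=> linT Tm Td; apply/funext => v; apply: sqnorm_eq0.
have T0 : T 0 = 0.
  by have := linT (-1) 0 0; rewrite scaler0 addr0 scaleN1r addNr.
have TA (r : seq G) : T (\sum_(h <- r) v h *: delta R h) = 0.
  elim: r => [|h r IH]; first by rewrite big_nil.
  by rewrite big_cons linT IH Td scaler0 addr0.
apply/eqP; rewrite eq_le sqnorm_ge0 andbT; apply/ler_addgt0Pr => e e0.
have m1 : 0 < 1 + `|m| by rewrite ltr_pwDl.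
rewrite add0r; have [A finA vA] := sqnorm_tail v (divr_gt0 e0 m1).
have -> : T v = T (v - restrict_ell2 A v).
  rewrite -[v in LHS](subrK (restrict_ell2 A v)) -[_ - _]scale1r linT !scale1r.
  by rewrite (restrict_finite _ finA) TA addr0.
apply: le_trans (Tm _) _.
apply: (@le_trans _ _ ((1 + `|m|) * (e / (1 + `|m|)))).
  apply: (@le_trans _ _ ((1 + `|m|) * sqnorm (v - restrict_ell2 A v))).
    by rewrite ler_wpM2r ?sqnorm_ge0// (le_trans (ler_norm m))// lerDr.
  by rewrite ler_wpM2l// ltW.
by rewrite mulrC divfK// gt_eqF.
Qed.

End Density.

(** One average has to work for all the given elements at once. This is
stronger than making each translation small by an average of its own: an
average that makes one translation small turns the others into sums of new
conjugates. *)
Definition averages_vanish (R : realType) (G : groupType) :=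
  forall (ts : seq G) (e : R), 0 < e -> 1%g \notin ts ->
  exists2 Phi, averaging Phi &
    forall t, t \in ts -> op_sqbound (Phi (@lregular R G t)) e.

Section AveragingCriterion.
Context (R : realType) (G : groupType).
Implicit Types (u v : ell2 R G) (S T : ell2 R G -> ell2 R G).

Lemma averaging_sum Phi (I : Type) (r : seq I) (a : I -> R[i])
    (F : I -> ell2 R G -> ell2 R G) : averaging Phi ->
  Phi (\sum_(i <- r) a i *: F i) = \sum_(i <- r) a i *: Phi (F i).
Proof.
move=> avgPhi; have lPhi := averaging_linear avgPhi.
have P0 : Phi 0 = 0.
  by have := lPhi (-1) 0 0; rewrite scaler0 addr0 scaleN1r addNr.
elim: r => [|i r IH]; first by rewrite !big_nil.
by rewrite !big_cons lPhi IH.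
Qed.

Lemma op_sqbound_sum (I : eqType) (r : seq I) (a : I -> R[i]) (m : R)
    (F : I -> ell2 R G -> ell2 R G) :
  (forall i, i \in r -> op_sqbound (F i) m) ->
  op_sqbound (\sum_(i <- r) a i *: F i)
    ((size r)%:R * (\sum_(i <- r) normc (a i) ^+ 2) * m).
Proof.
move=> Fm v.
have -> : (\sum_(i <- r) a i *: F i) v = \sum_(i <- r) a i *: F i v.
  by elim/big_rec2 : _ => // i x S _ <-.
apply: le_trans (sqnorm_sum_le _ _) _; rewrite -!mulrA ler_wpM2l//.
rewrite mulr_suml big_seq [leRHS]big_seq; apply: ler_sum => i ir.
by rewrite sqnormZ ler_wpM2l ?sqr_ge0// Fm.
Qed.

Lemma bounded_sqbound T : bounded_operators T -> exists m, op_sqbound T m.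
Proof.
move=> [_ [M TM]]; exists (`|M| ^+ 2); apply/op_norm_leP => // v.
by apply: le_trans (TM v) _; rewrite ler_wpM2r ?sqrtr_ge0// ler_norm.
Qed.

Lemma scale_id_bounded (c : R[i]) :
  bounded_operators (c *: (id : ell2 R G -> ell2 R G)).
Proof.
split=> [a u v|].
  by rewrite -[LHS]/(c *: (a *: u + v)) scalerDr !scalerA mulrC.
exists (normc c); apply/op_norm_leP; first exact: normc_ge0.
by move=> v; rewrite sqnormZ.
Qed.

(** Up to e the operator T is a finite combination of translations; an
average fixes its multiple of the identity and makes the other terms small,
so it moves T close to a scalar. The coefficient of the identity is read off
any diagonal entry, since a translation by t <> 1 has zeros on the diagonal. *)
Lemma average_near_coefficient T (h : G) (e : R) : 0 < e ->
  averages_vanish R G ->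
  reduced_Cstar_algebra T ->
  exists2 Phi, averaging Phi &
    op_sqbound (T (delta R h) h *: id - Phi T) (10 * e ^+ 2).
Proof.
move=> e0 avg [_ /(_ _ e0) [S [s SE] /(op_norm_leP _ (ltW e0)) TS]].
(* c' is the coefficient of the identity in the approximation S of T. *)
pose c' := \sum_(p <- s | p.2 == 1%g) p.1.
pose r := [seq p <- s | p.2 != 1%g].
pose Q : ell2 R G -> ell2 R G := \sum_(p <- r) p.1 *: lregular p.2.
have SQ : S = c' *: id + Q.
  rewrite SE (bigID (fun p => p.2 == 1%g))/= /Q big_filter; congr (_ + _).
  rewrite scaler_suml; apply: eq_bigr => p /eqP ->; congr (_ *: _).
  by apply/funext => v; exact: lregular1.
pose c := T (delta R h) h.
have Qh : Q (delta R h) h = 0.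
  have -> : Q (delta R h) = \sum_(p <- r) p.1 *: delta R (p.2 * h)%g.
    rewrite /Q; elim/big_rec2 : _ => // i x X _ <-.
    by rewrite -lregular_delta.
  rewrite ell2_sum big_seq big1// => p; rewrite mem_filter => /andP[p1 _].
  rewrite ell2Z /=; case: eqP => [/esym/eqP|_]; last by rewrite mulr0.
  by rewrite -[X in _ == X]mul1g => /eqP/mulIg/eqP; rewrite (negbTE p1).
have cc' : normc (c - c') ^+ 2 <= e ^+ 2.
  have -> : c - c' = ((T - S) (delta R h)) h.
    rewrite SQ -[RHS]/(c - (c' * delta R h h + Q (delta R h) h)) Qh /= eqxx.
    by rewrite mulr1 addr0.
  apply: le_trans (normc_le_sqnorm _ _) _; apply: le_trans (TS _) _.
  by rewrite sqnorm_delta mulr1.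
pose K := (size r)%:R * (\sum_(p <- r) normc p.1 ^+ 2).
have K0 : 0 <= K by rewrite mulr_ge0// sumr_ge0// => p _; exact: sqr_ge0.
have K1 : 0 < K + 1 by rewrite ltr_wpDl.
(* The denominator is K + 1 because K vanishes when r is empty. *)
have eta0 : 0 < e ^+ 2 / (K + 1) by rewrite divr_gt0// exprn_gt0.
have ts1 : 1%g \notin [seq p.2 | p <- r].
  by apply/mapP => -[p]; rewrite mem_filter => /andP[/eqP + _] /esym.
have [Phi avgPhi Phits] := avg _ _ eta0 ts1.
exists Phi => //.
have PQ : op_sqbound (Phi Q) (e ^+ 2).
  rewrite (averaging_sum _ _ _ avgPhi).
  apply: (@op_sqbound_le _ _ _ (K * (e ^+ 2 / (K + 1)))).
    rewrite mulrA ler_pdivrMr// mulrC ler_wpM2l ?sqr_ge0//; lra.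
  by apply: op_sqbound_sum => p pr; apply: Phits; apply/mapP; exists p.
have PTS := averaging_sqbound avgPhi TS.
have lPhi := averaging_linear avgPhi.
have -> : c *: id - Phi T =
    (c - c') *: id + (-1) *: (Phi (T - S) + Phi Q).
  have -> : Phi (T - S) = Phi T - (c' *: id + Phi Q).
    rewrite -[T - S]addrC -scaleN1r lPhi scaleN1r addrC SQ lPhi.
    by rewrite (averaging_id avgPhi).
  rewrite scaleN1r scalerBl; move: (c *: _) (c' *: _) (Phi T) (Phi Q).
  move=> a b x y; apply/funext => v.
  rewrite -[LHS]/(a v - x v) -[RHS]/(a v - b v - (x v - (b v + y v) + y v)).
  have -> : x v - (b v + y v) + y v = x v - b v by rewrite opprD addrA subrK.
  by rewrite opprB addrA subrK.
have id1 : op_sqbound (id : ell2 R G -> ell2 R G) 1 by move=> v; rewrite mul1r.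
apply: op_sqbound_le
  (op_sqboundD (op_sqboundZ _ id1) (op_sqboundZ (-1) (op_sqboundD PTS PQ))).
rewrite normcN normc1 expr1n mulr1 mul1r; lra.
Qed.

(** A nonzero T in an ideal has a nonzero matrix entry, and composing it with
a translation moves this entry to the diagonal. Averaging then stays in the
ideal and approximates a nonzero multiple of the identity, so that the closed
ideal contains the identity. *)
Theorem Cstar_simple_of_averaging :
  averages_vanish R G ->
  Cstar_simple R G.
Proof.
move=> avg J JI; have [JA J0 JL JM JC] := JI.
have [[T [JT T0]]|J00] := pselect (exists T, J T /\ T <> 0); last first.
  left; apply/seteqP; split=> [T JT|_ -> //].
  by apply: contrapT => T0; apply: J00; exists T.
right; have [[linT _] _] := JA T JT.
have [m Tm] := bounded_sqbound (JA T JT).1.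
have /existsNP[h Th] : ~ forall h, T (delta R h) = 0.
  by move=> /(operator_eq0 linT Tm).
have /existsNP[g Tg] : ~ forall g, T (delta R h) g = 0.
  by move=> Th0; apply: Th; apply: ell2P.
pose T' := lregular (h * g^-1)%g \o T.
have JT' : J T' by exact: (JM _ _ (lregular_reduced R _) JT).1.
pose c := T (delta R h) g.
have T'h : T' (delta R h) h = c by rewrite /T' /= invgM invgK mulgVK.
have Jc : J (c *: id).
  apply: JC; split; first exact: scale_id_bounded.
  move=> e e0; have e4 : 0 < e / 4 by lra.
  have [Phi avgPhi] := average_near_coefficient h e4 avg (JA _ JT').
  rewrite T'h => TP; exists (Phi T'); first exact: (averaging_ideal avgPhi JI).
  apply/op_norm_leP; first exact: ltW.
  by apply: op_sqbound_le TP; nra.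
have Jid : J id.
  have -> : id = c^-1 *: (c *: id) + 0 :> (ell2 R G -> ell2 R G).
    by rewrite addr0 scalerA mulVf ?scale1r//; exact/eqP.
  exact: JL.
apply/seteqP; split=> // S SA.
exact: (JM _ _ SA Jid).1.
Qed.

End AveragingCriterion.

(** * Averaging along a group action *)

Section Action.
Context (R : realType) (G : groupType) (T : topologicalType).
Context (act : G -> homeo T).
Hypothesis actM : {morph act : g h / (g * h)%g}.
Hypothesis act_inj : injective act.

Lemma actME g h x : act (g * h)%g x = act g (act h x).
Proof. by rewrite actM. Qed.

Lemma act1E x : act 1%g x = x.
Proof.
apply: (can_inj (homeo_funK (act 1%g))).
by rewrite -actME mulg1.
Qed.

Lemma actK g x : act g^-1%g (act g x) = x.
Proof. by rewrite -actME mulVg act1E. Qed.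

Lemma actVK g x : act g (act g^-1%g x) = x.
Proof. by rewrite -actME mulgV act1E. Qed.

Definition supported_in (V : set T) g := forall x, ~ V x -> act g x = x.

Lemma supported_stable V g x : supported_in V g -> V (act g x) <-> V x.
Proof.
move=> sg; split=> Vx; apply: contrapT => Vx'; last first.
  by apply: (Vx'); have := sg _ Vx' => /(congr1 (act g^-1%g)); rewrite !actK => ->.
by move: Vx; rewrite sg.
Qed.

Lemma supported_inV V g : supported_in V g -> supported_in V g^-1%g.
Proof. by move=> sg x Vx; rewrite -[x in LHS](sg x)// actK. Qed.

Definition stabilizes (V : set T) g := forall x, V (act g x) <-> V x.

(** A point x0 of V is transported along the cosets of the stabilizer of V:
each coset gets a representative r, and g is sent to the image of x0 under g
r^-1. Unlike the orbit map, this never leaves V, so that ping-pong inside V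
can be pulled back to the whole group. *)
Lemma equivariant_map (V : set T) : V !=set0 ->
  exists2 phi : G -> T, forall g, V (phi g) &
    forall k g, stabilizes V k -> phi (k * g)%g = act k (phi g).
Proof.
move=> [x0 Vx0].
pose coset g := [set r | stabilizes V (g * r^-1)%g].
pose r g := xget 1%g (coset g).
have rP g : stabilizes V (g * (r g)^-1)%g.
  rewrite -/(coset g (r g)) /r; case: xgetP => [y ->//|/(_ g)[]].
  by rewrite /coset /= mulgV => x; rewrite act1E.
have rM k g : stabilizes V k -> r (k * g)%g = r g.
  move=> Vk; rewrite /r; congr (xget _ _); apply/seteqP.
  have E y x : V (act (k * g * y^-1)%g x) <-> V (act (g * y^-1)%g x).
    by rewrite -mulgA (actME k); exact: Vk.
  split=> y Vy x; last exact: iff_trans (E y x) (Vy x).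
  exact: iff_trans (iff_sym (E y x)) (Vy x).
exists (fun g => act (g * (r g)^-1)%g x0) => [g|k g Vk]; first exact/rP.
by rewrite rM// -mulgA (actME k).
Qed.

(** If t moves V off itself, then s t s^-1 = (s (t s^-1 t^-1)) t, where the
factor t s^-1 t^-1 lives on the image of V under t. Hence the elements
h i = s i t (s i)^-1 t^-1 stabilize V and act there like the s i, which play
ping-pong. *)
Lemma displaced_average_sqnorm k (V : set T) (s : 'I_k -> G) (D : 'I_k -> set T)
    t (v : ell2 R G) :
  V !=set0 -> (forall i, supported_in V (s i)) -> trivIset setT D ->
  (forall i x, V x -> ~ D i (act (s i) x) -> D i x) ->
  (forall x, V x -> ~ V (act t x)) ->
  sqnorm (\sum_i lregular (s i * t * (s i)^-1)%g v) <= 4 * k%:R * sqnorm v.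
Proof.
move=> V0 sV Ddisj Ds tV.
have [phi phiV phiM] := equivariant_map V0.
pose h i := (s i * t * (s i)^-1 * t^-1)%g.
have tVV x : V x -> ~ V (act t^-1%g x) by move=> Vx /tV; rewrite actVK.
have hs i x : V x -> act (h i) x = act (s i) x.
  move=> Vx; rewrite /h !actME (supported_inV (sV i)) ?actVK//; exact: tVV.
have hst i : stabilizes V (h i).
  move=> x; split=> Vx; last by rewrite hs// supported_stable.
  have E : x = act (h i)^-1%g (act (h i) x) by rewrite actK.
  have Vy : V (act (s i)^-1%g (act (h i) x)).
    by rewrite supported_stable//; exact: supported_inV.
  move: (act (h i) x) Vx Vy E => y Vy Vsy ->.
  rewrite /h !invgM !invgK !actME (sV i) ?actVK//; exact: tVV.
rewrite -[in leRHS](sqnorm_lregular t).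
rewrite (eq_bigr (fun i => lregular (h i) (lregular t v))); last first.
  by move=> i _; rewrite -lregularM /h mulgVK.
apply: (@ping_pong_sqnorm _ _ _ _ (fun i => [set g | D i (phi g)])).
  by move=> i j _ _ [g [/= gi gj]]; apply: (Ddisj i j I I); exists (phi g).
move=> i g /=; rewrite phiM// hs//; exact: Ds.
Qed.

Hypothesis T_hausdorff : hausdorff_space T.
Hypothesis local_ping_pong : forall k (U : set T), open U -> U !=set0 ->
  exists (V : set T) (s : 'I_k -> G) (D : 'I_k -> set T),
  [/\ V !=set0, V `<=` U, forall i, supported_in V (s i), trivIset setT D &
      forall i x, V x -> ~ D i (act (s i) x) -> D i x].

Lemma displaced_open g (U : set T) x : open U -> U x -> act g x <> x ->
  exists V : set T, [/\ open V, V x, V `<=` U & forall y, V y -> ~ V (act g y)].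
Proof.
move=> oU Ux /eqP gx; move: T_hausdorff; rewrite open_hausdorff => /(_ _ _ gx).
move=> [[A B] /= [/set_mem Agx /set_mem Bx] [oA oB /eqP AB]].
exists (U `&` B `&` (act g @^-1` A)); split=> //.
- apply: openI; first exact: openI.
  by apply: open_comp => // y _; exact: homeo_fun_continuous.
- exact: subset_trans (@subIsetl _ _ _) (@subIsetl _ _ _).
- move=> y [_ Ay] [[_ By] _]; have /seteqP[/(_ (act g y)) + _] := AB.
  by apply.
Qed.

Lemma fixed_or_displaced (ts : seq G) (U : set T) : open U -> U !=set0 ->
  exists V : set T, [/\ open V, V !=set0, V `<=` U & forall t, t \in ts ->
    (forall x, V x -> act t x = x) \/ (forall x, V x -> ~ V (act t x))].
Proof.
elim: ts U => [|t ts IH] U oU U0; first by exists U; split.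
have [V [oV V0 VU Vts]] := IH U oU U0.
have [fix_t|] := pselect (forall x, V x -> act t x = x).
  exists V; split=> // t'; rewrite inE => /predU1P[->|/Vts//]; by left.
move=> /existsNP[x /not_implyP[Vx tx]].
have [W [oW Wx WV Wt]] := displaced_open oV Vx tx.
exists W; split=> //; first by exists x.
  exact: subset_trans VU.
move=> t'; rewrite inE => /predU1P[->|/Vts[t'V|t'V]]; first by right.
  by left=> y /WV /t'V.
by right=> y /WV /t'V t'y /WV.
Qed.

(** On a suitable small open set every given element either acts trivially or
is displacing, and the first one displaces. Conjugating by elements supported
there makes the displacing ones small and leaves the others unchanged, since
these commute with the conjugating elements; so the list that remains to be
treated is a strictly shorter part of the original one. *)
Lemma simultaneous_average : averages_vanish R G.
Proof.
move=> ts e e0; have [n] := ubnP (size ts).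
elim: n ts => // n IH [_ _|t0 ts sz ts1]; first by exists id.
have /existsNP[x0 tx0] : ~ forall x, act t0 x = x.
  move=> t0x; move: ts1; rewrite inE negb_or => /andP[/eqP + _]; apply.
  by apply: act_inj; apply: homeoP => x; rewrite t0x act1E.
have [U0 [oU0 U0x _ U0t]] := displaced_open openT I tx0.
have [U [oU Un0 UU0 Uts]] := fixed_or_displaced (t0 :: ts) oU0 (ex_intro _ _ U0x).
(* The average of k conjugates has squared norm at most (4 k) / k ^ 2. *)
pose k := (Num.truncn (4 / e)).+1.
have [V [s [D [V0 VU sV Ddisj Ds]]]] := local_ping_pong k oU Un0.
have ke : 4 / k%:R <= e :> R.
  rewrite ler_pdivrMr ?ltr0n// mulrC -ler_pdivrMr//; apply: ltW.
  exact: truncnS_gt.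
have sz_s : size (codom s) = k by rewrite size_codom card_ord.
have avg_s : averaging (@conj_avg R G (codom s)).
  by apply: averaging_conj; rewrite sz_s.
have fixed t : (forall x, V x -> act t x = x) ->
    conj_avg (codom s) (@lregular R G t) = lregular t.
  move=> tV; have comm g : g \in codom s -> (g * t * g^-1 = t)%g.
    move=> /codomP[i ->]; rewrite -[RHS](mulgK (s i)); congr (_ * _)%g.
    apply: act_inj; apply: homeoP => x; rewrite !actME.
    have [Vx|Vx] := pselect (V x).
      by rewrite tV// tV// supported_stable.
    rewrite [act (s i) x]sV// sV// => Vtx; apply: Vx.
    by rewrite -(actK t x) -[act t x]tV ?actK.
  apply/funext => v; rewrite conj_avgE.
  rewrite (eq_big_seq (fun=> lregular t v)); last first.
    by move=> g /comm gt; rewrite -!lregularM ?mulgA gt.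
  rewrite big_const_seq count_predT iter_addr_0 -(scaler_nat _ (lregular t v)).
  by rewrite scalerA mulVf ?scale1r// sz_s pnatr_eq0.
have displaced t : (forall x, V x -> ~ V (act t x)) ->
    op_sqbound (conj_avg (codom s) (@lregular R G t)) e.
  move=> tV; apply: op_sqbound_le ke _ => v; rewrite conj_avgE sqnormZ normc_natV.
  rewrite big_map big_enum /= sz_s.
  rewrite (eq_bigr (fun i => lregular (s i * t * (s i)^-1)%g v)); last first.
    by move=> i _; rewrite -!lregularM ?mulgA.
  have := displaced_average_sqnorm v V0 sV Ddisj Ds tV.
  have kn0 : k%:R != 0 :> R by rewrite pnatr_eq0.
  have k2 : 0 <= k%:R^-1 ^+ 2 :> R by rewrite sqr_ge0.
  move=> /(ler_wpM2l k2) /le_trans; apply; rewrite le_eqVlt; apply/orP; left.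
  by apply/eqP; field.
pose fx := fun t => `[< forall x, V x -> act t x = x >].
have [||Phi avgPhi Phits] := IH [seq t <- t0 :: ts | fx t].
- rewrite -ltnS; apply: leq_trans sz; rewrite ltnS /= ifF; last first.
    apply/asboolPn => t0V; have [x Vx] := V0; apply: (U0t x); first exact/UU0/VU.
    by rewrite t0V//; exact/UU0/VU.
  by rewrite ltnS size_filter count_size.
- by rewrite mem_filter negb_and ts1 orbT.
exists (Phi \o conj_avg (codom s)); first exact: averaging_comp.
move=> t tts /=; have [tV|tV] := Uts t tts.
  rewrite fixed => [|x /VU]; last exact: tV.
  by apply: Phits; rewrite mem_filter tts andbT; apply/asboolP => x /VU /tV.
by apply: (averaging_sqbound avgPhi); apply: displaced => x /VU /tV tx /VU.
Qed.

End Action.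

(** * Exchanges of bricks *)

Section Bricks.
Context (T : topologicalType) (I : Type) (E : I -> T -> T) (C : I -> set T).
Context (Icat : I -> I -> I) (shift : I -> T -> T) (x0 : T).
Hypothesis CE : forall i, C i = range (E i).
Hypothesis Ecat : forall i j x, E (Icat i j) x = E i (E j x).
Hypothesis IcatA : associative Icat.
Hypothesis EK : forall i, cancel (E i) (shift i).
Hypothesis E_continuous : forall i, continuous (E i).
Hypothesis shift_continuous : forall i, continuous (shift i).
Hypothesis C_open : forall i, open (C i).

Definition decides (p u : I) :=
  (exists q, p = Icat u q) \/ C p `&` C u = set0.

(** The pieces of the partition decide all the bricks that contain w, as do
the words of the length of w in the case of cylinders. *)
Hypothesis C_refine : forall w, exists m (e : 'I_m -> I),
  partition setT (C \o e) setT /\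
  forall i u q, w = Icat u q -> decides (e i) u.

Definition brickwise (f : T -> T) := exists m (e d : 'I_m -> I),
  [/\ partition setT (C \o e) setT, partition setT (C \o d) setT &
      forall i x, f (E (e i) x) = E (d i) x].

Lemma mem_brick i x : C i (E i x).
Proof. by rewrite CE; exists x. Qed.

Lemma brickP i x : C i x -> exists y, x = E i y.
Proof. by rewrite CE => -[y _ <-]; exists y. Qed.

Lemma brick_cat i j x : C (Icat i j) (E i x) <-> C j x.
Proof.
split=> [/brickP[y]|/brickP[y ->]]; last by rewrite -Ecat; exact: mem_brick.
by rewrite Ecat => /(can_inj (EK i)) ->; exact: mem_brick.
Qed.

Lemma involution_brickwise f m (e d : 'I_m -> I) : involutive f ->
  partition setT (C \o e) setT -> (forall i x, f (E (e i) x) = E (d i) x) ->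
  continuous f /\ brickwise f.
Proof.
move=> fK Pe fE; have [covE disjE _] := Pe.
have inE x : exists i y, x = E (e i) y.
  have : [set: T] x by [].
  by rewrite -covE => -[i _ /brickP[y ->]]; exists i, y.
split.
  apply/continuousP => A oA.
  rewrite (_ : _ @^-1` _ = \bigcup_i (C (e i) `&`
      (E (d i) \o shift (e i)) @^-1` A)); last first.
    apply/seteqP; split=> [x /= fx|_ [i _ [/brickP[x ->]]] /=].
      have [i [y xy]] := inE x; exists i => //.
      rewrite xy /=; split; first exact: mem_brick.
      by rewrite EK -fE -xy.
    by rewrite EK fE.
  apply: bigcup_open => i _; apply: openI => //.
  apply: open_comp => // x _; apply: continuous_comp.
    exact: shift_continuous.
  exact: E_continuous.
exists m, e, d; split=> //; split.
- apply/seteqP; split=> // x _; have [i [y fx]] := inE (f x).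
  by exists i => //=; rewrite -(fK x) fx fE; exact: mem_brick.
- move=> i j _ _ [x [/brickP[y ->] /brickP[z]]].
  rewrite -!fE => /(can_inj fK) yz; apply: disjE => //.
  exists (E (e i) y); split; first exact: mem_brick.
  by rewrite yz; exact: mem_brick.
- by move=> i _; exists (E (d i) x0); exact: mem_brick.
Qed.

(** The involution that exchanges the complement of the brick w with its copy
inside w, and fixes the remaining part, which is the brick w w. It maps the
complement of w into w whatever the number of pieces that this complement
splits into, which may be incongruent to that of w modulo the number of
letters minus one; this is why one formula serves all alphabets. *)
Definition exchange w y :=
  if y \in C w then (if shift w y \in C w then y else shift w y) else E w y.

Definition exchange_in v w x :=
  if x \in C v then E v (exchange w (shift v x)) else x.

Lemma exchange_out w y : ~ C w y -> exchange w y = E w y.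
Proof. by move=> wy; rewrite /exchange memNset. Qed.

Lemma exchange_once w y : ~ C w y -> exchange w (E w y) = y.
Proof.
move=> wy; rewrite /exchange EK mem_set; last exact: mem_brick.
by rewrite memNset.
Qed.

Lemma exchange_twice w y : exchange w (E w (E w y)) = E w (E w y).
Proof. by rewrite /exchange EK !mem_set//; exact: mem_brick. Qed.

Lemma exchangeK w : involutive (exchange w).
Proof.
move=> y; have [/brickP[z ->]|wy] := pselect (C w y); last first.
  by rewrite (exchange_out wy) exchange_once.
have [/brickP[y' ->]|wz] := pselect (C w z); first by rewrite !exchange_twice.
by rewrite exchange_once// exchange_out.
Qed.

Lemma exchange_inE v w y : exchange_in v w (E v y) = E v (exchange w y).
Proof. by rewrite /exchange_in EK mem_set//; exact: mem_brick. Qed.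

Lemma exchange_in_out v w x : ~ C v x -> exchange_in v w x = x.
Proof. by move=> vx; rewrite /exchange_in memNset. Qed.

Lemma exchange_inK v w : involutive (exchange_in v w).
Proof.
move=> x; have [/brickP[z ->]|vx] := pselect (C v x); last first.
  by rewrite !exchange_in_out.
by rewrite !exchange_inE exchangeK.
Qed.

(** A partition that decides the bricks v, v w and v w w separates the four
cases in the definition of the exchange; the word v w w w extends all three. *)
Lemma exchange_in_pieces v w : exists m (e d : 'I_m -> I),
  partition setT (C \o e) setT /\
  forall i x, exchange_in v w (E (e i) x) = E (d i) x.
Proof.
have [m [e [Pe eP]]] := C_refine (Icat (Icat (Icat v w) w) w).
suff /choice[d dP] : forall i, exists d,
    forall x, exchange_in v w (E (e i) x) = E d x by exists m, e, d.
move=> i; have disj p u x : C p `&` C u = set0 -> ~ C u (E p x).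
  by move=> /seteqP[+ _] ux => /(_ (E p x)); apply; split=> //; exact: mem_brick.
have W : Icat (Icat (Icat v w) w) w = Icat v (Icat w (Icat w w)).
  by rewrite !IcatA.
have [[p ep]|vi] := eP i v _ W; last first.
  by exists (e i) => x; rewrite exchange_in_out//; exact: disj.
have [[q eq]|vwi] := eP i (Icat v w) _ (esym (IcatA _ _ _)); last first.
  exists (Icat v (Icat w p)) => x; have := disj _ _ x vwi.
  by rewrite ep !Ecat exchange_inE brick_cat => wx; rewrite exchange_out.
have [[r er]|vwwi] := eP i (Icat (Icat v w) w) _ erefl; last first.
  exists (Icat v q) => x; have := disj _ _ x vwwi.
  rewrite eq !Ecat exchange_inE -IcatA !brick_cat => wx.
  by rewrite exchange_once.
by exists (e i) => x; rewrite er !Ecat exchange_inE exchange_twice.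
Qed.

Lemma exchange_in_brickwise v w :
  continuous (exchange_in v w) /\ brickwise (exchange_in v w).
Proof.
have [m [e [d [Pe fE]]]] := exchange_in_pieces v w.
exact: involution_brickwise (@exchange_inK v w) Pe fE.
Qed.

Definition exchange_homeo (v w : I) : homeo T :=
  let fc := (exchange_in_brickwise v w).1 in
  Homeo (@exchange_inK v w) (@exchange_inK v w) fc fc.

Hypothesis C_basis : forall (U : set T) x, open U -> U x -> exists i, C i `<=` U.
Hypothesis C_disjoint : forall k, exists w : 'I_k -> I, trivIset setT (C \o w).
Hypothesis T_hausdorff : hausdorff_space T.

(** Inside a given brick v, the exchanges along disjoint bricks w i play
ping-pong with the bricks v (w i). *)
Theorem Cstar_simple_of_brickwise (R : realType) (G : groupType)
    (act : G -> homeo T) :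
  {morph act : g h / (g * h)%g} -> injective act ->
  (forall f : homeo T, brickwise f -> exists g, act g = f) ->
  Cstar_simple R G.
Proof.
move=> actM act_inj actP; apply: Cstar_simple_of_averaging.
apply: (simultaneous_average actM act_inj T_hausdorff) => k U oU [x Ux].
have [v vU] := C_basis oU Ux.
have [w wdisj] := C_disjoint k.
have /choice[s sE] i : exists g, act g = exchange_homeo v (w i).
  by apply: actP; exact: (exchange_in_brickwise v (w i)).2.
exists (C v), s, (fun i => C (Icat v (w i))); split=> //.
- by exists (E v x0); exact: mem_brick.
- by move=> i y vy; rewrite sE; exact: exchange_in_out.
- move=> i j _ _ [y [/brickP[z ->]]]; rewrite Ecat brick_cat => wj.
  by apply: wdisj => //; exists (E (w i) z); split=> //; exact: mem_brick.
- move=> i _ /brickP[y ->]; rewrite sE /= exchange_inE !brick_cat.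
  by apply: contra_notP => /exchange_out ->; exact: mem_brick.
Qed.

End Bricks.

(** * Sequences and words *)

Lemma cvg_coordinatewise (I : Type) (K : I -> topologicalType) (S : Type)
    (F : set_system S) (f : S -> prod_topology K) (l : prod_topology K) :
  Filter F -> (forall i, (fun x => f x i) @ F --> l i) -> f @ F --> l.
Proof.
move=> FF fl; apply/cvg_sup => i U [V [[W oW <-] /= Wl WU]].
apply: (filterS WU); apply: fl; exact: open_nbhs_nbhs.
Qed.

Section Sequences.
Context (K : discreteTopologicalType).
Notation T := (prod_topology (fun _ : nat => K)).
Implicit Types (w : seq K) (x y : nat -> K).

Lemma eventually_eq_cvg (y : nat -> T) (x : T) :
  (forall n k, (k < n)%N -> y n k = x k) -> y @ \oo --> x.
Proof.
move=> yx; apply: cvg_coordinatewise => k; apply/discrete_cvg.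
by exists k.+1 => // n /= kn; exact: yx.
Qed.

Lemma coordinate_continuous k : continuous (fun x : T => x k).
Proof. exact: (@proj_continuous _ (fun _ : nat => K) k). Qed.

Lemma continuous_coordinatewise (S : topologicalType) (f : S -> T) :
  (forall k, continuous (fun s => f s k)) -> continuous f.
Proof. by move=> fc s; apply: cvg_coordinatewise => k; exact: fc. Qed.

Lemma discrete_continuous (S : topologicalType) (f : K -> S) : continuous f.
Proof.
move=> a A /nbhs_singleton fA.
by apply: open_nbhs_nbhs; split=> //; exact: discrete_open.
Qed.

Lemma prepend_continuous w : continuous (prepend w : T -> T).
Proof.
apply: continuous_coordinatewise => k x.
apply: (@continuous_comp _ _ _
  (fun x : T => x (k - size w)%N) (fun a => nth a w k)).
  exact: coordinate_continuous.
exact: discrete_continuous.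
Qed.

Definition shift_by (n : nat) (x : nat -> K) : nat -> K := fun k => x (n + k)%N.

Lemma shift_by_continuous n : continuous (shift_by n : T -> T).
Proof.
by apply: continuous_coordinatewise => k x; exact: coordinate_continuous.
Qed.

Lemma prependK w : cancel (prepend w) (shift_by (size w)).
Proof. by move=> x; apply/funext => k; exact: prepend_shift. Qed.

Lemma cylinder_open w : open (cylinder w : set T).
Proof.
rewrite openE => x wx.
have near_x (k : 'I_(size w)) : nbhs (x : T) [set s : T | s k = x k].
  exact: (@coordinate_continuous k x [set x k] (discrete_set1 _)).
apply: filterS (filter_forall _ near_x) => y yx.
rewrite /cylinder /= -[RHS](wx : mkseq x (size w) = w); apply/eq_in_map => k.
rewrite mem_iota add0n => /andP[_ kw].
exact: (yx (Ordinal kw)).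
Qed.

Lemma mem_cylinder_mkseq n x k y :
  cylinder (mkseq x n) y -> (k < n)%N -> y k = x k.
Proof.
rewrite /cylinder /= size_mkseq => yx kn.
by rewrite -(nth_mkseq (x k) y kn) yx nth_mkseq.
Qed.

(** Otherwise there would be sequences outside U agreeing with x on longer
and longer prefixes, and these converge to x. *)
Lemma cylinder_basis (U : set T) x : open U -> U x ->
  exists w, cylinder w `<=` U.
Proof.
move=> oU Ux; apply: contrapT => noU.
have /choice[y yP] n : exists y, cylinder (mkseq x n) y /\ ~ U y.
  apply: contrapT => /forallNP yU; apply: noU; exists (mkseq x n) => y yn.
  by apply: contrapT => Uy; exact: (yU y).
have : (y : nat -> T) @ \oo --> (x : T).
  by apply: eventually_eq_cvg => n k; apply: mem_cylinder_mkseq; case: (yP n).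
move=> /(_ U (open_nbhs_nbhs (conj oU Ux)))[n _ /(_ n (leqnn n))] /=.
by case: (yP n).
Qed.

End Sequences.

Section Words.
Context (X : finType).
Implicit Types (w : seq X) (x : nat -> X).

Lemma prefix_or_disjoint (p u : seq X) : (size u <= size p)%N ->
  (exists q, p = u ++ q) \/ cylinder p `&` cylinder u = set0.
Proof.
move=> up; have [pu|pu] := eqVneq (take (size u) p) u.
  left; exists (drop (size u) p).
  by rewrite -[in RHS]pu -{1}(size_takel up) cat_take_drop.
right; apply/seteqP; split=> // x [/= xp xu]; move/eqP: pu; apply.
by rewrite -xp -map_take take_iota (minn_idPl up).
Qed.

Lemma word_partition (a : X) N :
  partition setT (fun t : N.-tuple X => cylinder t) [set: nat -> X].
Proof.
split.
- apply/seteqP; split=> // x _; have sz : size (mkseq x N) == N.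
    by rewrite size_mkseq.
  by exists (Tuple sz) => //; rewrite /cylinder /= size_mkseq.
- move=> s t _ _ [x [/= xs xt]]; apply: val_inj.
  by rewrite -[LHS]xs -[RHS]xt !size_tuple.
- move=> t _; exists (prepend t (fun=> a)); exact: mkseq_prepend.
Qed.

Lemma partition_enum (S : Type) (J : finType) (F : J -> set S) :
  partition setT F setT -> partition [set: 'I_#|J|] (F \o enum_val) setT.
Proof.
move=> [cov triv ne]; split=> [|i j _ _|i _]; last exact: ne.
  apply/seteqP; split=> // x _; have : [set: S] x by [].
  by rewrite -cov => -[j _ jx]; exists (enum_rank j); rewrite //= enum_rankK.
by move=> /(triv _ _ I I)/enum_val_inj.
Qed.

Lemma cylinder_refine (a : X) w : exists m (e : 'I_m -> seq X),
  partition setT (@cylinder X \o e) setT /\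
  forall i u q, w = u ++ q ->
    (exists q, e i = u ++ q) \/ cylinder (e i) `&` cylinder u = set0.
Proof.
exists #|{: (size w).-tuple X}|, (fun i => tval (enum_val i)); split.
  exact: partition_enum (word_partition a (size w)).
move=> i u q wuq; apply: prefix_or_disjoint.
by rewrite size_tuple wuq size_cat leq_addr.
Qed.

(** The words a^i b are pairwise incomparable. *)
Lemma cylinder_disjoint (a b : X) k : a != b ->
  exists w : 'I_k -> seq X, trivIset setT (@cylinder X \o w).
Proof.
move=> ab; exists (fun i : 'I_k => rcons (nseq i a) b) => i j _ _ [x [/= xi xj]].
have lt (i' j' : 'I_k) : cylinder (rcons (nseq i' a) b) x ->
    cylinder (rcons (nseq j' a) b) x -> (j' <= i')%N.
  rewrite /cylinder /= !size_rcons !size_nseq => xi' xj'.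
  rewrite leqNgt; apply/negP => ij'; move/eqP: ab; apply.
  have <- : x i' = b.
    by rewrite -(nth_mkseq a x (ltnSn i')) xi' nth_rcons size_nseq ltnn eqxx.
  rewrite -(nth_mkseq a x (ltnW ij' : (i' < j'.+1)%N)) xj'.
  by rewrite nth_rcons size_nseq ij' nth_nseq ij'.
by apply: val_inj; apply/eqP; rewrite eqn_leq !lt.
Qed.

End Words.

(** * The three families of groups *)

Lemma thompsonV_Cstar_simple (R : realType) : Cstar_simple R thompsonV.
Proof.
apply: (@Cstar_simple_of_brickwise cantor_space (seq bool) (@prepend bool)
  (@cylinder bool) cat (fun w => shift_by (size w)) (fun=> false)
  (@cylinderE bool) (@prepend_cat bool) (@catA bool) (@prependK bool)
  (@prepend_continuous bool) (fun w => @shift_by_continuous bool (size w))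
  (@cylinder_open bool) (cylinder_refine false) (@cylinder_basis bool)
  (fun k => @cylinder_disjoint _ true false k isT) cantor_space_hausdorff
  R thompsonV thompsonV_val) => [g h||f [m [e [d [Pe Pd fE]]]]].
- exact: valM.
- exact: val_inj.
have fV : f \in thompsonV_pred by apply/asboolP; exists m, e, d.
by exists (ThompsonV fV).
Qed.

Section BrinBricks.
Context (n : nat).
Implicit Types (w : 'I_n -> seq bool) (x : cantor_cube n).

Definition brick_shift w x : cantor_cube n :=
  fun j => shift_by (size (w j)) (x j).

Lemma coordinate_cube_continuous j : continuous (fun x => x j).
Proof. exact: (@proj_continuous _ (fun _ : 'I_n => cantor_space) j). Qed.

Lemma brickE w : brick w = range (prepend_brick w).
Proof.
apply/seteqP; split=> [x xw|_ [x _ <-] j]; last exact: mkseq_prepend.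
have /choice[y yE] j : exists y, prepend (w j) y = x j.
  by have := xw j; rewrite cylinderE => -[y _ <-]; exists y.
by exists y => //; apply/funext.
Qed.

Lemma cube_continuous (f : 'I_n -> cantor_space -> cantor_space) :
  (forall j, continuous (f j)) ->
  continuous ((fun x j => f j (x j)) : cantor_cube n -> cantor_cube n).
Proof.
move=> fc x; apply: cvg_coordinatewise => j.
apply: (@continuous_comp _ _ _ (fun x : cantor_cube n => x j) (f j)).
  exact: coordinate_cube_continuous.
exact: fc.
Qed.

Lemma brick_open w : open (brick w).
Proof.
rewrite openE => x wx.
have near_x j : nbhs x [set y : cantor_cube n | cylinder (w j) (y j)].
  apply: (@coordinate_cube_continuous j x (cylinder (w j))).
  by apply: open_nbhs_nbhs; split; [exact: (@cylinder_open bool)|exact: wx].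
exact: filterS (filter_forall _ near_x).
Qed.

Lemma brick_basis (U : set (cantor_cube n)) x : open U -> U x ->
  exists w, brick w `<=` U.
Proof.
move=> oU Ux; apply: contrapT => noU.
have /choice[y yP] N : exists y, brick (fun j => mkseq (x j) N) y /\ ~ U y.
  apply: contrapT => /forallNP yU; apply: noU.
  exists (fun j => mkseq (x j) N) => y yn.
  by apply: contrapT => Uy; exact: (yU y).
have : y @ \oo --> x.
  apply: cvg_coordinatewise => j.
  apply: (@eventually_eq_cvg bool (fun N => y N j)) => N k.
  by apply: mem_cylinder_mkseq; case: (yP N).
move=> /(_ U (open_nbhs_nbhs (conj oU Ux)))[N _ /(_ N (leqnn N))] /=.
by case: (yP N).
Qed.

(** Each coordinate is cut at the common depth N, which is at least the depth
of w in every coordinate. *)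
Lemma brick_refine w : exists m (e : 'I_m -> 'I_n -> seq bool),
  partition setT (@brick n \o e) setT /\
  forall i u q, w = (fun j => u j ++ q j) ->
    (exists q, e i = fun j => u j ++ q j) \/ brick (e i) `&` brick u = set0.
Proof.
pose N := \max_j size (w j); pose J := {ffun 'I_n -> N.-tuple bool}.
have [cov triv ne] := word_partition false N.
exists #|J|, (fun i j => tval ((enum_val i : J) j)); split.
  apply: (@partition_enum _ J (fun t => brick (fun j => tval (t j)))); split.
  - apply/seteqP; split=> // x _.
    have /choice[t tx] j : exists t : N.-tuple bool, cylinder t (x j).
      have : [set: nat -> bool] (x j) by [].
      by rewrite -cov => -[t _ tx]; exists t.
    by exists [ffun j => t j] => // j; rewrite ffunE.
  - move=> s t _ _ [x [xs xt]]; apply/ffunP => j; apply: triv => //.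
    by exists (x j); split; [exact: xs|exact: xt].
  - move=> t _; exists (fun j => prepend (t j) (fun=> false)) => j.
    exact: mkseq_prepend.
move=> i u q wuq; pose p j := tval ((enum_val i : J) j).
have up j : (size (u j) <= size (p j))%N.
  rewrite size_tuple; apply: (@leq_trans (size (w j))).
    by rewrite wuq size_cat leq_addr.
  by rewrite /N (bigD1 j)//= leq_maxl.
have [/choice[r rE]|/existsNP[j /forallNP pj]] :=
    pselect (forall j, exists r, p j = u j ++ r).
  by left; exists r; apply/funext.
right; apply/seteqP; split=> // x [/(_ j) xp /(_ j) xu].
have [[r pr]|/seteqP[+ _]] := prefix_or_disjoint (up j); first by case: (pj r).
by apply; split; [exact: xp|exact: xu].
Qed.

Lemma brick_disjoint k : (0 < n)%N ->
  exists w : 'I_k -> 'I_n -> seq bool, trivIset setT (@brick n \o w).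
Proof.
move=> n0; have [w wdisj] := @cylinder_disjoint _ true false k isT.
exists (fun i _ => w i) => i j _ _ [x [xi xj]]; apply: wdisj => //.
by exists (x (Ordinal n0)); split; [exact: xi|exact: xj].
Qed.

Lemma brinV_Cstar_simple (R : realType) : (0 < n)%N -> Cstar_simple R (brinV n).
Proof.
move=> n0.
apply: (@Cstar_simple_of_brickwise (cantor_cube n) _ (@prepend_brick n)
  (@brick n) (fun v w j => v j ++ w j) brick_shift (fun _ _ => false)
  brickE _ _ _ _ _ brick_open brick_refine brick_basis
  (fun k => brick_disjoint k n0) _ R (brinV n) (@brinV_val n)) => [||||||g h||f].
- by move=> v w x; apply/funext => j; exact: prepend_cat.
- by move=> u v w; apply/funext => j; exact: catA.
- by move=> w x; apply/funext => j; exact: prependK.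
- move=> w; apply: (@cube_continuous (fun j => prepend (w j))) => j.
  exact: (@prepend_continuous bool).
- move=> w; apply: (@cube_continuous (fun j => shift_by (size (w j)))) => j.
  exact: (@shift_by_continuous bool).
- apply: (@hausdorff_product 'I_n (fun=> cantor_space)) => _.
  exact: cantor_space_hausdorff.
- exact: valM.
- exact: val_inj.
move=> [m [e [d [Pe Pd fE]]]].
have fV : f \in @brinV_pred n by apply/asboolP; exists m, e, d.
by exists (BrinV fV).
Qed.

End BrinBricks.

Lemma nekrashevychV_Cstar_simple (R : realType) (X : finType)
    (G : selfSimilarGroup X) :
  (1 < #|X|)%N -> Cstar_simple R (nekrashevychV G).
Proof.
move=> /card_gt1P[a [b [_ _ ab]]]; pose K := discrete_topology X.
apply: (@Cstar_simple_of_brickwise (sequence_space X) (seq X) (@prepend X)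
  (@cylinder X) cat (fun w => @shift_by K (size w)) (fun=> a)
  (@cylinderE X) (@prepend_cat X) (@catA X) (@prependK K)
  (@prepend_continuous K) (fun w => @shift_by_continuous K (size w))
  (@cylinder_open K) (cylinder_refine a) (@cylinder_basis K)
  (fun k => @cylinder_disjoint _ a b k ab) _
  R (nekrashevychV G) (@nekrashevychV_val X G)) => [|g h||f].
- by apply: hausdorff_product => _; exact: discrete_hausdorff.
- exact: valM.
- exact: val_inj.
move=> [m [e [d [Pe Pd fE]]]].
have fV : f \in nekrashevychV_pred G.
  apply/asboolP; exists m, e, d, (fun=> 1%g); split=> // i x.
  by rewrite ssg_boundary1 fE.
by exists (NekrashevychV fV).
Qed.

Theorem theorem4p5 (R : realType) :
  Cstar_simple R thompsonV /\
  (forall n : nat, (2 <= n)%N -> Cstar_simple R (brinV n)) /\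
  (forall (X : finType) (G : selfSimilarGroup X), (2 <= #|X|)%N ->
     countable [set: G]%classic -> Cstar_simple R (nekrashevychV G)).
Proof.
split; first exact: thompsonV_Cstar_simple.
split=> [n n2|X G X2 _]; last exact: nekrashevychV_Cstar_simple.
by apply: brinV_Cstar_simple; exact: ltnW.
Qed.
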